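(* Let $n\ge1$ be an integer, $s\in(0,1)$ and $u\in C_c^\infty(\mathbb{R}^n)$. With $\mathbb{R}^{n+1}_+=\mathbb{R}^n\times(0,\infty)$, let, for $(x,t)\in\mathbb{R}^{n+1}_+$, $$w_s(x,t)=p_{n,s}\int_{\mathbb{R}^n}\frac{t^{2s}u(y)}{(|x-y|^2+t^2)^{\frac{n+2s}{2}}}\,dy,\qquad v_s(x,t)=p_{n,s}\,t^{2s}\int_{\mathbb{R}^n}\frac{2\ln t-\ln(|x-y|^2+t^2)}{(|x-y|^2+t^2)^{\frac{n+2s}{2}}}\,u(y)\,dy,$$ and let $w_s(x,0)=u(x)$ and $v_s(x,0)=b_1u(x)$ be their boundary values at $t=0$, where $p_{n,s},\mathbf{d}_s,b_1,b_{n,s}$ are the constants defined in the context. Then $v_s$ is a solution of the inhomogeneous Dirichlet problem $$\begin{cases}\operatorname{div}_{(x,t)}\bigl(t^{1-2s}\nabla_{(x,t)}v_s\bigr)=2t^{-2s}\,\partial_tw_s&\text{in }\mathbb{R}^{n+1}_+,\\ v_s(\cdot,0)=b_1u&\text{on }\mathbb{R}^n.\end{cases}$$ Moreover, for $x\in\mathbb{R}^n$, $$(-\Delta)^{s+\mathrm{Log}}u(x)=-\lim_{t\to0^+}\mathbf{d}_s\Bigl[(b_{n,s}-2\ln t)\,t^{-2s}\bigl(w_s(x,t)-w_s(x,0)\bigr)+t^{-2s}\bigl(v_s(x,t)-v_s(x,0)\bigr)\Bigr].$$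
   Context: Constants: $c_{n,s}=2^{2s}\pi^{-n/2}s\frac{\Gamma((n+2s)/2)}{\Gamma(1-s)}$; $p_{n,s}=\Bigl(\int_{\mathbb{R}^n}(|z|^2+1)^{-\frac{n+2s}{2}}dz\Bigr)^{-1}=\pi^{-n/2}\frac{\Gamma((n+2s)/2)}{\Gamma(s)}$; $\mathbf{d}_s=\frac{c_{n,s}}{p_{n,s}}=2^{2s}\frac{s\,\Gamma(s)}{\Gamma(1-s)}$; $b_1=p_{n,s}\int_{\mathbb{R}^n}\frac{-\ln(|z|^2+1)}{(|z|^2+1)^{\frac{n+2s}{2}}}dz$; $b_{n,s}=\frac{d}{ds}\ln c_{n,s}=\ln4+\frac1s+\psi(1-s)+\psi(\frac{n+2s}{2})$, $\psi=\Gamma'/\Gamma$. The function $w_s$ solves $\operatorname{div}_{(x,t)}(t^{1-2s}\nabla_{(x,t)}w_s)=0$ in $\mathbb{R}^{n+1}_+$, $w_s(\cdot,0)=u$ on $\mathbb{R}^n$, and $v_s=p_{n,s}\,\partial_s(w_s/p_{n,s})$. Boundary values at $t=0$ are understood as limits $t\to0^+$. The fractional-logarithmic Laplacian is $(-\Delta)^{s+\mathrm{Log}}u(x):=\frac{d}{d\tau}(-\Delta)^\tau u(x)\big|_{\tau=s}$, where $(-\Delta)^\tau u(x)=c_{n,\tau}\,\mathrm{p.v.}\int_{\mathbb{R}^n}\frac{u(x)-u(y)}{|x-y|^{n+2\tau}}dy$ for $0<\tau<1$. *)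

(* Defs.v *)
From HB Require Import structures.
From mathcomp Require Import all_boot all_order all_algebra.
From mathcomp Require Import all_classical all_reals all_analysis.
Set Implicit Arguments.
Unset Strict Implicit.
Unset Printing Implicit Defensive.
Import Order.TTheory GRing.Theory Num.Theory.
Import numFieldNormedType.Exports.
Local Open Scope classical_set_scope.
Local Open Scope ring_scope.

(* MathComp-Analysis has no n-dimensional Lebesgue measure: it is built here on
   n.-tuple R (with its product sigma-algebra), by taking products with the
   one-dimensional measure; see lebesgue_Rn_box. *)
Section lebesgue_Rn.
Variable R : realType.
Local Notation mR := (measurableTypeR R).

Definition cons_tuple (n : nat) (p : mR * n.-tuple mR) : n.+1.-tuple mR :=
  [the n.+1.-tuple mR of p.1 :: p.2].

Lemma measurable_cons_tuple (n : nat) :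
  measurable_fun [set: mR * n.-tuple mR] (@cons_tuple n).
Proof. exact: measurable_cons. Qed.

Definition uncons_tuple (n : nat) (x : n.+1.-tuple mR) : mR * n.-tuple mR :=
  (thead x, [tuple of behead x]).

Lemma measurable_uncons_tuple (n : nat) :
  measurable_fun [set: n.+1.-tuple mR] (@uncons_tuple n).
Proof.
apply/measurable_fun_pairP; split; first exact: measurable_tnth.
exact: measurable_behead.
Qed.

Lemma cons_tupleK (n : nat) : cancel (@cons_tuple n) (@uncons_tuple n).
Proof.
by move=> [a x]; rewrite /uncons_tuple theadE; congr pair; exact/val_inj.
Qed.

Section step.
Variables (n : nat) (mu : {sigma_finite_measure set (n.-tuple mR) -> \bar R}).

Definition lebesgue_Rn_step : set (n.+1.-tuple mR) -> \bar R :=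
  pushforward (@lebesgue_measure R \x mu)%E (@cons_tuple n).

Let nu : {measure set (n.+1.-tuple mR) -> \bar R} :=
  measure_function_pushforward__canonical__measure_function_Measure
    (@lebesgue_measure R \x mu)%E (@measurable_cons_tuple n).

HB.instance Definition _ := Measure.copy lebesgue_Rn_step nu.

Let step_sigma_finite : sigma_finite setT lebesgue_Rn_step.
Proof.
have /sigma_finiteP[F [TF ndF Foo]] := sigma_finiteT (@lebesgue_measure R).
have /sigma_finiteP[G [TG ndG Goo]] := sigma_finiteT mu.
exists (fun i => @uncons_tuple n @^-1` (F i `*` G i)).
  apply/esym; rewrite -subTset => x _.
  have [i _ Fi] : (\bigcup_i F i) (uncons_tuple x).1 by rewrite -TF.
  have [j _ Gj] : (\bigcup_i G i) (uncons_tuple x).2 by rewrite -TG.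
  exists (maxn i j) => //; split.
    by move: Fi; exact/subsetPset/ndF/leq_maxl.
  by move: Gj; exact/subsetPset/ndG/leq_maxr.
move=> i; have [mFi Fioo] := Foo i; have [mGi Gioo] := Goo i; split.
  rewrite -[X in measurable X]setTI; apply: measurable_uncons_tuple => //.
  exact: measurableX.
rewrite /lebesgue_Rn_step /pushforward -comp_preimage.
rewrite (_ : uncons_tuple (n:=n) \o cons_tuple (n:=n) = id); last first.
  by apply/funext => x /=; exact: cons_tupleK.
by rewrite preimage_id product_measure1E// lte_mul_pinfty// ge0_fin_numE.
Qed.

HB.instance Definition _ :=
  Measure_isSigmaFinite.Build _ _ _ lebesgue_Rn_step step_sigma_finite.

End step.

Fixpoint lebesgue_Rn (n : nat) : {sigma_finite_measure set (n.-tuple mR) -> \bar R} :=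
  if n is m.+1 then lebesgue_Rn_step (lebesgue_Rn m) else dirac [tuple of [::]].

Lemma lebesgue_Rn_box (n : nat) (A : 'I_n -> set mR) :
  (forall i, measurable (A i)) ->
  lebesgue_Rn n [set x | forall i, A i (tnth x i)] =
  (\prod_(i < n) lebesgue_measure (A i))%E.
Proof.
elim: n A => [|n IH] A mA.
  by rewrite big_ord0 /= diracE mem_set// => -[].
rewrite big_ord_recl -IH//= /lebesgue_Rn_step /pushforward.
rewrite -product_measure1E//.
  congr ((_ \x _)%E _); apply/seteqP; split=> [[a x] /= H|[a x] /= [Aa H] i].
    by split=> [|i]; [exact: (H ord0)|have := H (lift ord0 i); rewrite tnthS].
  case: (unliftP ord0 i) => [j ->|->//]; rewrite tnthS; exact: H.
rewrite (_ : mkset _ = \bigcap_(i in [set: 'I_n])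
    (@tnth n mR ^~ i @^-1` A (lift ord0 i))).
  apply: fin_bigcap_measurable => // i _.
  by rewrite -[X in measurable X]setTI; exact: measurable_tnth.
by apply/seteqP; split=> x /= H i; [move=> _|]; exact: H.
Qed.

End lebesgue_Rn.

Section real_analysis.
Variable R : realType.

Definition Gamma (a : R) : R :=
  \int[lebesgue_measure]_(t in `]0, +oo[%classic) (t `^ (a - 1) * expR (- t)).

(* n.-tuple R carries the measure, 'rV[R]_n the normed-space structure *)
Definition point (n : nat) (y : n.-tuple (measurableTypeR R)) : 'rV[R]_n :=
  \row_i tnth y i.

Definition integral_Rn (n : nat) (D : set 'rV[R]_n) (f : 'rV[R]_n -> R) : R :=
  \int[lebesgue_Rn R n]_(y in @point n @^-1` D) f (point y).

(* the norm `|x| of 'rV[R]_n is the sup norm *)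
Definition enorm (n : nat) (x : 'rV[R]_n) : R :=
  Num.sqrt (\sum_(i < n) x ord0 i ^+ 2).

Fixpoint n_times_differentiable (n k : nat) (f : 'rV[R]_n -> R) : Prop :=
  if k is k'.+1 then
    (forall x, differentiable f x) /\
    (forall v, n_times_differentiable k' (fun x => 'D_v f x))
  else True.

Definition smooth (n : nat) (f : 'rV[R]_n -> R) : Prop :=
  forall k, n_times_differentiable k f.

Definition compactly_supported (n : nat) (f : 'rV[R]_n -> R) : Prop :=
  compact (closure [set x | f x != 0]).

(* Points (x, t) of R^(n+1) are pairs in 'rV[R]_n * R. *)
Definition ex (n : nat) (i : 'I_n) : 'rV[R]_n * R := (delta_mx ord0 i, 0).
Definition et (n : nat) : 'rV[R]_n * R := (0, 1).

Definition half_space (n : nat) : set ('rV[R]_n * R) := [set z | 0 < z.2].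

Definition gradient (n : nat) (f : 'rV[R]_n * R -> R) (z : 'rV[R]_n * R) :
    'rV[R]_n * R :=
  (\row_i 'D_(ex i) f z, 'D_(et n) f z).

Definition divergence (n : nat) (X : 'rV[R]_n * R -> 'rV[R]_n * R)
    (z : 'rV[R]_n * R) : R :=
  \sum_(i < n) 'D_(ex i) (fun y => (X y).1 ord0 i) z +
  'D_(et n) (fun y => (X y).2) z.

(* 'D_v f z has an arbitrary value when the derivative does not exist *)
Definition has_gradient (n : nat) (f : 'rV[R]_n * R -> R) z : Prop :=
  (forall i, derivable f z (ex i)) /\ derivable f z (et n).

Definition has_divergence (n : nat) (X : 'rV[R]_n * R -> 'rV[R]_n * R) z : Prop :=
  (forall i, derivable (fun y => (X y).1 ord0 i) z (ex i)) /\
  derivable (fun y => (X y).2) z (et n).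

Definition weighted_gradient (n : nat) (s : R) (f : 'rV[R]_n * R -> R)
    (z : 'rV[R]_n * R) : 'rV[R]_n * R :=
  (z.2 `^ (1 - 2 * s)) *: gradient f z.

Definition has_boundary_values (n : nat) (f : 'rV[R]_n * R -> R)
    (g : 'rV[R]_n -> R) : Prop :=
  forall x, f (x, t) @[t --> 0^'+] --> g x.

Definition boundary_value (n : nat) (f : 'rV[R]_n * R -> R) (x : 'rV[R]_n) : R :=
  lim (f (x, t) @[t --> 0^'+]).

Definition solves_weighted_dirichlet (n : nat) (s : R)
    (v h : 'rV[R]_n * R -> R) (g : 'rV[R]_n -> R) : Prop :=
  (forall z, half_space z ->
     [/\ has_gradient v z, has_divergence (weighted_gradient s v) z &
         divergence (weighted_gradient s v) z = h z]) /\
  has_boundary_values v g.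

End real_analysis.

Section fractional_laplacian.
Variables (R : realType) (n : nat).
Implicit Types (s : R) (u : 'rV[R]_n -> R) (x : 'rV[R]_n).

Definition c_ns s : R :=
  2 `^ (2 * s) * pi `^ (- (n%:R / 2)) * s *
  (Gamma ((n%:R + 2 * s) / 2) / Gamma (1 - s)).

(* equal to pi^(-n/2) Gamma((n + 2s)/2) / Gamma(s) *)
Definition p_ns s : R :=
  (integral_Rn setT
     (fun z : 'rV[R]_n => (enorm z ^+ 2 + 1) `^ (- ((n%:R + 2 * s) / 2))))^-1.

(* equal to 2^(2s) s Gamma(s) / Gamma(1 - s), which does not depend on n *)
Definition d_s s : R := c_ns s / p_ns s.

Definition b_1 s : R :=
  p_ns s * integral_Rn setT
    (fun z : 'rV[R]_n =>
       - ln (enorm z ^+ 2 + 1) / (enorm z ^+ 2 + 1) `^ ((n%:R + 2 * s) / 2)).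

(* equal to ln 4 + 1/s + psi(1 - s) + psi((n + 2s)/2) with psi = Gamma'/Gamma *)
Definition b_ns s : R := derive1 (fun tau => ln (c_ns tau)) s.

Definition w_s s u (z : 'rV[R]_n * R) : R :=
  p_ns s * integral_Rn setT
    (fun y => z.2 `^ (2 * s) * u y /
       (enorm (z.1 - y) ^+ 2 + z.2 ^+ 2) `^ ((n%:R + 2 * s) / 2)).

Definition v_s s u (z : 'rV[R]_n * R) : R :=
  p_ns s * z.2 `^ (2 * s) * integral_Rn setT
    (fun y => (2 * ln z.2 - ln (enorm (z.1 - y) ^+ 2 + z.2 ^+ 2)) /
       (enorm (z.1 - y) ^+ 2 + z.2 ^+ 2) `^ ((n%:R + 2 * s) / 2) * u y).

Definition truncated_integral s u x (e : R) : R :=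
  integral_Rn [set y | e < enorm (x - y)]
    (fun y => (u x - u y) / enorm (x - y) `^ (n%:R + 2 * s)).

(* the limit e -> 0+ of the truncated integrals is the principal value *)
Definition fractional_laplacian s u x : R :=
  c_ns s * lim (truncated_integral s u x e @[e --> 0^'+]).

Definition fractional_log_laplacian s u x : R :=
  derive1 (fun tau => fractional_laplacian tau u x) s.

(* lim and the derivative above are total functions: this says that the
   principal values and the derivative exist *)
Definition fractional_log_laplacian_defined s u x : Prop :=
  (forall tau, 0 < tau < 1 -> cvg (truncated_integral tau u x e @[e --> 0^'+])) /\
  derivable (fun tau => fractional_laplacian tau u x) s 1.

End fractional_laplacian.

(* Main.v *)
(* Write a = (n + 2s)/2 and q = |x - y|^2 + t^2, so that w_s = p t^(2s) int q^(-a) u(y) dy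
   and v_s = p t^(2s) int (2 ln t - ln q) q^(-a) u(y) dy.

   Equation: int phi(q) m(y) dy has t-derivative 2t int phi'(q) m and x_i-derivative
   2 x_i int phi'(q) m - 2 int phi'(q) y_i m.  Everything is therefore expressed with the
   integrals of q^(-a-k) and ln q q^(-a-k), k = 0, 1, 2, and |x - y|^2 = q - t^2 turns the
   equation into an algebraic identity.

   Limit: substitute y = x + z.  The kernels are even in z, so u(x+z) - u(x) may be replaced
   by -D(z)/2 with D(z) = 2u(x) - u(x+z) - u(x-z) = O(min(1, |z|^2)).  Scaling gives
   p t^(2s) int q^(-a) = 1 and p t^(2s) int (2 ln t - ln q) q^(-a) = b_1; the terms in ln t
   cancel and the bracket times d_s is -(c/2) (b int D q^(-a) - int D ln q q^(-a)).  By dominated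
   convergence it tends to -(c/2) (b int D |z|^(-n-2s) - 2 int D ln|z| |z|^(-n-2s)), which is
   minus the derivative of (c/2) int D |z|^(-n-2s) = (-Delta)^s u(x), since c' = b c.

   Polar coordinates are avoided: |z| >= |z_i| bounds a power of |z| by a product of powers
   of the coordinates, which is integrated by Tonelli. *)
Require Import Defs.
From mathcomp Require Import all_boot all_order all_algebra.
From mathcomp Require Import all_classical all_reals all_analysis.
From mathcomp Require Import measurable_realfun ring lra.
Set Implicit Arguments.
Unset Strict Implicit.
Unset Printing Implicit Defensive.
Import Order.TTheory GRing.Theory Num.Theory.
Import numFieldNormedType.Exports.
Local Open Scope classical_set_scope.
Local Open Scope ring_scope.

(** * Lebesgue measure on tuples *)

(** Limits, derivatives and integrals are total functions here, so existence has to be carried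
    along: derivatives travel as [is_derive] statements, and each linear rearrangement of integrals
    is paid for with integrability. Logarithms get no integrability theory of their own. The
    inequality |ln r| <= (r^e + r^(-e))/e trades a logarithm for a shift of s by a small amount in
    both directions, which is harmless because 0 < s < 1 is an open condition. Hence one dominator,
    |D| times a sum of two powers of |z|, serves both the derivative in s and the limits t -> 0. In
    D = O(min(1, |z|^2)) the factor |z|^2 repairs the origin exactly when s < 1, and boundedness
    suffices at infinity exactly when s > 0. At z = 0 the kernels take default values, and D(0) = 0
    removes that point from every estimate. In the equation all derivatives fall on the kernel, so u
    enters only as a bounded measurable function vanishing off a box. That class is stable under
    multiplication by y_i, which each derivative in x_i produces. *)

Section affine_1d.
Variable R : realType.
Local Notation mR := (measurableTypeR R).
Local Notation mu := (@lebesgue_measure R).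
Variables (b c : R).
Hypothesis c0 : c != 0.

Let aff (x : mR) : mR := b + c * x.

Let maff : measurable_fun [set: mR] aff.
Proof. by apply: measurable_funD => //; exact: measurable_funM. Qed.

Let nu : {measure set mR -> \bar R} :=
  mscale `|c|%:nng (measure_function_pushforward__canonical__measure_function_Measure mu maff).

(** By uniqueness of Lebesgue measure it is enough to compare both sides on half-open intervals. For
    c < 0 the preimage is half-open on the other side, which does not change its length. *)
Lemma lebesgue_measure_affine (A : set mR) : measurable A ->
  mu A = (`|c|%:E * mu ((fun x => b + c * x)%R @^-1` A))%E.
Proof.
move=> mA; rewrite (@lebesgue_measure_unique R nu)//.
move=> X [[r1 r2] /= _ <-]; 
change (mu `]r1, r2]%classic = (`|c|%:E * mu (aff @^-1` `]r1, r2]))%E).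
have [cgt|clt] : 0 < c \/ c < 0 by apply/orP; rewrite -neq_lt eq_sym.
- have -> : aff @^-1` `]r1, r2] = `](r1 - b) / c, (r2 - b) / c]%classic.
    by apply/seteqP; split=> x /=; rewrite !in_itv/= /aff ltr_pdivrMr// ler_pdivlMr//
      (mulrC x) ltrBlDl lerBrDl.
  rewrite !lebesgue_measure_itv/= !lte_fin ltr_pM2r ?invr_gt0// ltrD2r.
  case: ifPn => _; last by rewrite mule0.
  by rewrite -!EFinB -EFinM gtr0_norm//; congr (_%:E); field.
- have -> : aff @^-1` `]r1, r2] = `[(r2 - b) / c, (r1 - b) / c[%classic.
    by apply/seteqP; split=> x /=; rewrite !in_itv/= /aff ler_ndivrMr// ltr_ndivlMr//
      (mulrC x) lerBrDl ltrBlDl andbC.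
  rewrite !lebesgue_measure_itv/= !lte_fin ltr_nM2r ?invr_lt0// ltrD2r.
  case: ifPn => _; last by rewrite mule0.
  by rewrite -!EFinB -EFinM ltr0_norm//; congr (_%:E); field.
Qed.

Lemma ge0_integral_affine (f : mR -> \bar R) : measurable_fun setT f ->
  (forall x, 0 <= f x)%E ->
  (\int[mu]_x f x = `|c|%:E * \int[mu]_x f (b + c * x)%R)%E.
Proof.
move=> mf f0.
transitivity (\int[nu]_x f x)%E.
  by apply: eq_measure_integral => A mA _; exact: lebesgue_measure_affine.
rewrite /nu ge0_integral_mscale//; congr (_ * _)%E.
by rewrite (@ge0_integral_pushforward _ _ _ _ _ aff).
Qed.

End affine_1d.

Section lebesgue_Rn_tonelli.
Variable R : realType.
Local Notation mR := (measurableTypeR R).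
Local Notation mu := (@lebesgue_measure R).
Local Notation muN := (lebesgue_Rn R).

Lemma ge0_integral_lebesgue_RnS (n : nat) (f : n.+1.-tuple mR -> \bar R) :
  measurable_fun setT f -> (forall y, 0 <= f y)%E ->
  (\int[muN n.+1]_y f y =
   \int[mu]_a \int[muN n]_y f (@Defs.cons_tuple R n (a, y)))%E.
Proof.
move=> mf f0.
have mc := @measurable_cons_tuple R n.
transitivity (\int[pushforward (mu \x muN n)%E (@Defs.cons_tuple R n)]_y f y)%E.
  by apply: eq_measure_integral.
rewrite ge0_integral_pushforward//.
rewrite preimage_setT fubini_tonelli1//; last by move=> x; exact: f0.
exact: measurableT_comp mf mc.
Qed.

Lemma measurable_integral_cons_tuple (n : nat) (f : n.+1.-tuple mR -> \bar R) :
  measurable_fun setT f -> (forall y, 0 <= f y)%E ->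
  measurable_fun setT (fun a : mR => \int[muN n]_y f (@Defs.cons_tuple R n (a, y)))%E.
Proof.
move=> mf f0; pose h := f \o @Defs.cons_tuple R n.
have mh : measurable_fun setT h.
  by apply: measurableT_comp => //; exact: measurable_cons_tuple.
by apply: (@measurable_fun_fubini_tonelli_F _ _ _ _ _ (muN n) h) => // x; exact: f0.
Qed.

Definition affine_tuple (n : nat) (b : 'rV[R]_n) (c : R) (y : n.-tuple mR) :
    n.-tuple mR :=
  [tuple b ord0 i + c * tnth y i | i < n].

Lemma point_affine_tuple n (b : 'rV[R]_n) c y :
  Defs.point (affine_tuple b c y) = b + c *: Defs.point y.
Proof. by apply/rowP => i; rewrite !mxE tnth_mktuple. Qed.

Lemma measurable_affine_tuple n (b : 'rV[R]_n) c :
  measurable_fun setT (affine_tuple b c).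
Proof.
apply/measurable_fun_tnthP => i.
rewrite (_ : _ \o _ = fun y : n.-tuple mR => b ord0 i + c * tnth y i); last first.
  by apply/funext => y /=; rewrite tnth_mktuple.
by apply: measurable_funD => //; apply: measurable_funM => //; exact: measurable_tnth.
Qed.

Lemma affine_tuple_cons n (b : 'rV[R]_n.+1) c (a : mR) (y : n.-tuple mR) :
  affine_tuple b c (Defs.cons_tuple (a, y)) =
  Defs.cons_tuple (b ord0 ord0 + c * a : mR,
              affine_tuple (\row_i b ord0 (lift ord0 i)) c y).
Proof.
apply: eq_from_tnth => i; rewrite tnth_mktuple.
case: (unliftP ord0 i) => [j ->|->].
  by rewrite !tnthS tnth_mktuple mxE.
by rewrite !tnth0.
Qed.

(** Induction on the dimension through Tonelli: the head coordinate contributes one factor |c| by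
    the one-dimensional case, the tail contributes |c|^n by induction. *)
Lemma ge0_integral_affine_tuple n (b : 'rV[R]_n) (c : R) (f : n.-tuple mR -> \bar R) :
  c != 0 -> measurable_fun setT f -> (forall y, 0 <= f y)%E ->
  (\int[muN n]_y f y = (`|c| ^+ n)%:E * \int[muN n]_y f (affine_tuple b c y))%E.
Proof.
move=> c0; elim: n b f => [|n IH] b f mf f0.
  rewrite expr0 mul1e; apply: eq_integral => y _; congr f.
  by apply: eq_from_tnth => -[].
rewrite ge0_integral_lebesgue_RnS//.
rewrite ge0_integral_lebesgue_RnS//; last first.
  by apply: measurableT_comp => //; exact: measurable_affine_tuple.
under [in RHS]eq_integral => a _.
  under eq_integral => y _ do rewrite affine_tuple_cons.
  over.
pose g (a : mR) := (\int[muN n]_y f (@Defs.cons_tuple R n (a, y)))%E.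
have mg : measurable_fun setT g by exact: measurable_integral_cons_tuple.
have g0 a : (0 <= g a)%E by apply: integral_ge0.
rewrite -/g (@ge0_integral_affine R (b ord0 ord0) c c0 g)// /g.
rewrite exprS EFinM -muleA; congr (_ * _)%E.
pose b' := \row_i b ord0 (lift ord0 i).
have IHa a : (\int[muN n]_y f (@Defs.cons_tuple R n (a, y)) = (`|c| ^+ n)%:E *
    \int[muN n]_y f (@Defs.cons_tuple R n (a, affine_tuple b' c y)))%E.
  apply: (IH b' (fun y => f (@Defs.cons_tuple R n (a, y)))) => //.
  apply: measurableT_comp => //.
  by apply: measurable_cons; [exact: measurable_cst|exact: measurable_id].
rewrite -ge0_integralZl//.
- by apply: eq_integral => a _; exact: IHa.
(* Measurability of inner integrals is known for functions of an (n+1)-tuple. So [h] substitutes in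
   the tail only, and the substitution in the head is composed afterwards. *)
- pose h (z : n.+1.-tuple mR) := f (Defs.cons_tuple ((uncons_tuple z).1, affine_tuple b' c (uncons_tuple z).2)).
  have mh : measurable_fun setT h.
    apply: measurableT_comp => //; apply: measurable_cons.
      exact: measurable_tnth.
    exact: (measurableT_comp (measurable_affine_tuple b' c) (@measurable_behead _ mR _)).
  have mA := @measurable_integral_cons_tuple n h mh (fun y => f0 _).
  have mB : measurable_fun setT (fun a : mR => b ord0 ord0 + c * a : mR).
    by apply: measurable_funD => //; exact: measurable_funM.
  apply: eq_measurable_fun (measurableT_comp mA mB) => a _ /=.
  by apply: eq_integral => y _; rewrite /h cons_tupleK.
- by move=> a _; exact: integral_ge0.
Qed.

Lemma measurable_prod_tuple m (g : mR -> \bar R) : measurable_fun setT g ->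
  measurable_fun setT (fun y : m.-tuple mR => \prod_(i < m) g (tnth y i))%E.
Proof.
move=> mg; elim: m => [|m IHm].
    by under eq_fun do rewrite big_ord0; exact: measurable_cst.
  under eq_fun do rewrite big_ord_recl.
  apply: emeasurable_funM.
    by apply: measurableT_comp => //; exact: measurable_tnth.
  apply: eq_measurable_fun (measurableT_comp IHm (@measurable_behead _ mR _)) => y _ /=.
  apply: eq_bigr => i _; congr g.
  by rewrite tnth_behead; congr tnth; apply: val_inj; rewrite /= inordK// ltnS.
Qed.

Lemma ge0_integral_prod_tuple n (g : mR -> \bar R) :
  measurable_fun setT g -> (forall a, 0 <= g a)%E ->
  (\int[muN n]_y (\prod_(i < n) g (tnth y i)) = \prod_(i < n) \int[mu]_a g a)%E.
Proof.
move=> mg g0; elim: n => [|n IH].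
  rewrite !big_ord0.
  under eq_integral do rewrite big_ord0.
  by rewrite integral_cst// mul1e /= diracE mem_set.
have mp m := @measurable_prod_tuple m g mg.
have p0 m (y : m.-tuple mR) : (0 <= \prod_(i < m) g (tnth y i))%E.
  by apply: prode_ge0.
rewrite ge0_integral_lebesgue_RnS//.
transitivity (\int[mu]_a (g a * \prod_(i < n) \int[mu]_a g a))%E.
  apply: eq_integral => a _; rewrite -IH -ge0_integralZl//; last exact: mp.
  apply: eq_integral => y _; rewrite big_ord_recl tnth0; congr (_ * _)%E.
  by apply: eq_bigr => i _; rewrite tnthS.
rewrite big_ord_recl muleC -ge0_integralZl//=.
  by apply: eq_integral => a _; rewrite muleC.
by apply: prode_ge0 => i _; exact: integral_ge0.
Qed.

End lebesgue_Rn_tonelli.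

(** * Integrals of powers on the line *)

Section power_weight.
Variable R : realType.
Local Notation mR := (measurableTypeR R).
Local Notation mu := (@lebesgue_measure R).

Lemma integral_powR_itv (p a b : R) : p != 1 -> 0 < a -> a < b ->
  (\int[mu]_(x in `[a, b]) (x `^ (- p))%:E =
   ((b `^ (1 - p) - a `^ (1 - p)) / (1 - p))%:E)%E.
Proof.
move=> p1 a0 ab.
have p1' : 1 - p != 0 by rewrite subr_eq0 eq_sym.
pose F (x : R) := (1 - p)^-1 * x `^ (1 - p).
have dF (x : R) : 0 < x -> is_derive x 1 F (x `^ (- p)).
  move=> x0; rewrite /F.
  have := is_derive1_powR (1 - p) x0 => dP.
  apply: is_derive_eq.
  by rewrite /GRing.scale /= mulrA mulVf// mul1r; congr (_ `^ _); lra.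
have dc (c x : R) : 0 < x -> {for x, continuous (fun x : R => x `^ c)}.
  move=> x0; apply: differentiable_continuous; apply/derivable1_diffP.
  by have := is_derive1_powR c x0 => -[].
have Fc (x : R) : 0 < x -> {for x, continuous F}.
  move=> x0; apply: differentiable_continuous; apply/derivable1_diffP.
  by have [] := dF x x0.
rewrite (@continuous_FTC2 _ _ F)//.
- by rewrite /F -EFinB -mulrBr mulrC.
- apply: continuous_in_subspaceT => x; rewrite inE/= in_itv/= => /andP[ax _].
  by apply: dc; apply: lt_le_trans ax.
- split.
  + move=> x; rewrite in_itv/= => /andP[ax _].
    by have [] := dF x (lt_trans a0 ax).
  + by apply: cvg_at_right_filter; exact: Fc.
  + by apply: cvg_at_left_filter; apply: Fc; exact: lt_trans ab.
- move=> x; rewrite in_itv/= => /andP[ax _].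
  by rewrite derive1E; have [_ ->] := dF x (lt_trans a0 ax).
Qed.

(* The value at 0 must be +oo: the domination |z|^(-n al) <= prod_i |z_i|^(-al) would
   fail at z_i = 0 with the convention 0 `^ (- al) = 0. *)
Definition power_weight (al be r : R) : \bar R :=
  if r == 0 then +oo%E else
  if `|r| <= 1 then (`|r| `^ (- al))%:E else (`|r| `^ (- be))%:E.

Lemma power_weight_ge0 al be r : (0 <= power_weight al be r)%E.
Proof.
rewrite /power_weight; case: ifP => // _; case: ifP => _; rewrite lee_fin powR_ge0//.
Qed.

Lemma measurable_power_weight al be :
  measurable_fun setT (power_weight al be : mR -> \bar R).
Proof.
have mp c : measurable_fun setT (fun r : mR => (`|r| `^ c)%:E).
  apply/measurable_EFinP.
  exact: (measurableT_comp (@measurable_powR R c) (@normr_measurable R setT)).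
apply: measurable_fun_ifT => //.
  exact: measurable_fun_eqr.
apply: measurable_fun_ifT => //.
by apply: measurable_fun_ler => //; exact: normr_measurable.
Qed.

Lemma power_weight_posE al be r : 0 < r ->
  power_weight al be r = (if r <= 1 then r `^ (- al) else r `^ (- be))%:E.
Proof.
by move=> r0; rewrite /power_weight gt_eqF// gtr0_norm//; case: ifP.
Qed.

(** The half-line is exhausted by the compact intervals [1/(k+2), k+2], on which the fundamental
    theorem of calculus applies. The shift by 2 places 1 strictly inside, where the weight changes
    exponent. The two halves stay below 1/(1 - al) and 1/(be - 1), uniformly in k. *)
Lemma integral_power_weight_pos (al be : R) : al < 1 -> 1 < be ->
  (\int[mu]_(r in `]0%R, +oo[) power_weight al be r < +oo)%E.
Proof.
move=> al1 be1.
pose F (k : nat) := `[(k.+2%:R : R)^-1, k.+2%:R]%classic.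
have k0 (k : nat) : 0 < (k.+2%:R : R)^-1 by rewrite invr_gt0.
have k1 (k : nat) : (k.+2%:R : R)^-1 < 1.
  by rewrite invf_lt1// ltr1n.
have -> : `]0, +oo[%classic = \bigcup_k F k.
  apply/seteqP; split => x /=; rewrite ?in_itv/= ?andbT.
    move=> x0.
    have [k kx] : exists k : nat, Num.max x x^-1 <= k%:R.
      by exists (Num.truncn (Num.max x x^-1)).+1; apply/ltW/truncnS_gt.
    exists k => //; rewrite /F/= in_itv/=.
    move: kx; rewrite ge_max => /andP[xk xk'].
    have kk : (k%:R : R) <= k.+2%:R by rewrite ler_nat; exact: leqW.
    rewrite (le_trans xk)// andbT -[leRHS]invrK lef_pV2 ?posrE ?invr_gt0//.
    exact: le_trans xk' kk.
  by case=> k _; rewrite /F/= in_itv/= => /andP[kx _]; exact: lt_le_trans kx.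
have mw (A : set mR) : measurable_fun A (power_weight al be).
  by apply: measurable_funTS; exact: measurable_power_weight.
have ndF : nondecreasing_seq F.
  move=> i j ij; rewrite subsetEset; apply: subset_itv; rewrite bnd_simp.
    by rewrite lef_pV2 ?posrE// ler_nat.
  by rewrite ler_nat.
have mF i : measurable (F i : set mR) by exact: measurable_itv.
have cv := @ge0_nondecreasing_set_cvg_integral _ mR R F _ mu ndF mF
  (fun i => mw (F i)) (fun i x _ => power_weight_ge0 al be x).
apply: (@le_lt_trans _ _ ((1 - al)^-1 + (be - 1)^-1)%:E); last exact: ltry.
rewrite -(cvg_lim _ cv)//; apply: lime_le.
  by apply/cvg_ex; eexists; exact: cv.
apply: nearW => k; rewrite /F.
rewrite (@itv_bndbnd_setU _ _ _ (BRight 1)); last 2 first.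
- by rewrite bnd_simp ltW.
- by rewrite bnd_simp ler1n.
rewrite ge0_integral_setU//=; last 2 first.
- by move=> x _; exact: power_weight_ge0.
- rewrite disj_set2E; apply/eqP/seteqP; split => // x [] /=; rewrite !in_itv/=.
  by move=> /andP[_ x1] /andP[]; rewrite ltNge x1.
rewrite EFinD; apply: leeD.
  rewrite (eq_integral (fun x : mR => (x `^ (- al))%:E)); last first.
    move=> x; rewrite inE/= in_itv/= => /andP[kx x1].
    by rewrite power_weight_posE ?x1// (lt_le_trans _ kx).
  rewrite integral_powR_itv// ?lt_eqF//.
  by rewrite lee_fin powR1 -[leRHS]mul1r ler_pM2r ?invr_gt0 ?subr_gt0//.
apply: (@le_trans _ _ (\int[mu]_(x in `[1%R, k.+2%:R]) (x `^ (- be))%:E)%E).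
  rewrite (eq_integral (fun x : mR => (x `^ (- be))%:E)); last first.
    move=> x; rewrite inE/= in_itv/= => /andP[x1 _].
    by rewrite power_weight_posE ?leNgt ?x1// (lt_trans _ x1).
  apply: ge0_subset_integral => //.
  - apply/measurable_EFinP; apply: measurable_funTS; exact: measurable_powR.
  - by move=> x _; rewrite lee_fin powR_ge0.
  - by apply: subset_itvr; rewrite bnd_simp.
rewrite integral_powR_itv// ?gt_eqF// ?ltr1n//.
rewrite lee_fin powR1 -mulrNN -invrN opprB opprB -[leRHS]mul1r.
by rewrite ler_pM2r ?invr_gt0 ?subr_gt0//= gerBl powR_ge0.
Qed.

(** The weight is even and infinite only at 0, a null set. Away from 0 it is the sum of its
    restriction [f] to the positive axis and the reflection of [f], which has the same integral. *)
Lemma integral_power_weight (al be : R) : al < 1 -> 1 < be ->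
  (\int[mu]_r power_weight al be r < +oo)%E.
Proof.
move=> al1 be1; have P := integral_power_weight_pos al1 be1.
have mw (A : set mR) : measurable_fun A (power_weight al be).
  by apply: measurable_funTS; exact: measurable_power_weight.
pose f (r : mR) := (power_weight al be \_ `]0, +oo[) r.
have mf : measurable_fun setT f by exact/(measurable_restrictT _ _).1.
have f0 r : (0 <= f r)%E by apply: erestrict_ge0 => x _; exact: power_weight_ge0.
rewrite -(@integral_setD1 _ _ 0)//.
apply: (@le_lt_trans _ _ (\int[mu]_r (f r + f (0 + -1 * r)%R))%E).
  rewrite integral_mkcond; apply: ge0_le_integral => //.
  - by move=> x _; apply: erestrict_ge0 => y _; exact: power_weight_ge0.
  - by apply/(measurable_restrictT _ _).1 => //; exact: measurableD.
  - apply: emeasurable_funD => //; apply: measurableT_comp => //.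
    by apply: measurable_funD => //; exact: measurable_funM.
  - move=> x _; rewrite /f !patchE; case: ifPn; last first.
      by move=> _; rewrite adde_ge0//; case: ifP => // _; exact: power_weight_ge0.
    rewrite inE/= => -[_ /eqP x0].
    rewrite add0r mulN1r; case: ifPn => [_|]; last first.
      rewrite notin_setE/= in_itv/= andbT => /negP; rewrite -leNgt => x1.
      rewrite mem_set/= ?in_itv/= ?andbT ?oppr_gt0 ?lt_neqAle ?x0//.
      by rewrite add0e /power_weight normrN oppr_eq0.
    by rewrite leeDl//; case: ifP => // _; exact: power_weight_ge0.
rewrite ge0_integralD//; last first.
  apply: measurableT_comp => //.
  by apply: measurable_funD => //; exact: measurable_funM.
have := @ge0_integral_affine R 0 (-1) _ f mf f0.
rewrite normrN1 mul1e => <-; last by rewrite oppr_eq0 oner_eq0.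
by rewrite /f -integral_mkcond lte_add_pinfty.
- exact: measurableD.
- exact: mw.
Qed.

End power_weight.

(** * Measurability and radial domination on R^n *)

Section Rn_integration.
Variables (R : realType) (n : nat).
Local Notation mR := (measurableTypeR R).
Local Notation mu := (@lebesgue_measure R).
Local Notation muN := (lebesgue_Rn R).
Implicit Types (f g : 'rV[R]_n -> R) (z : 'rV[R]_n).

Definition measurable_Rn f :=
  measurable_fun [set: n.-tuple mR] (fun y => f (Defs.point y)).

Definition integrable_Rn f :=
  (muN n).-integrable [set: n.-tuple mR] (EFin \o (fun y => f (Defs.point y))).

Lemma integrable_Rn_measurable f : integrable_Rn f -> measurable_Rn f.
Proof. by move=> /measurable_int/measurable_EFinP. Qed.

Lemma measurable_coord (i : 'I_n) : measurable_Rn (fun z => z ord0 i).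
Proof.
rewrite /measurable_Rn; under eq_fun do rewrite mxE.
exact: measurable_tnth.
Qed.

Lemma measurable_box (A : 'I_n -> set mR) : (forall i, measurable (A i)) ->
  measurable [set y : n.-tuple mR | forall i, A i (tnth y i)].
Proof.
move=> mA.
rewrite (_ : mkset _ = \bigcap_(i in [set: 'I_n])
  ((fun y : n.-tuple mR => tnth y i) @^-1` A i)).
  apply: fin_bigcap_measurable => // i _.
  by rewrite -[X in measurable X]setTI; apply: measurable_tnth.
by apply/seteqP; split=> y /= H i => [_|]; exact: H.
Qed.

(** This links the topology of row vectors with the product sigma-algebra of tuples. Balls of the
    sup norm are boxes, hence measurable, and an open set is the countable union of the balls it
    contains with rational centre and radius 1/(k+1). *)
Lemma measurable_point_open (O : set 'rV[R]_n) : open O ->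
  measurable [set y : n.-tuple mR | O (Defs.point y)].
Proof.
move=> oO.
pose rball (q : 'rV[rat]_n * nat) : set 'rV[R]_n :=
  ball (map_mx ratr q.1 : 'rV[R]_n) (q.2.+1%:R^-1).
have mb q : measurable [set y : n.-tuple mR | rball q (Defs.point y)].
  pose A (i : 'I_n) := (fun a : mR => `|ratr (q.1 ord0 i) - a|) @^-1` `]-oo, (q.2.+1%:R^-1 : R)[.
  have mA i : measurable (A i).
    rewrite -[A i]setTI.
    have : measurable_fun setT (fun a : mR => `|ratr (q.1 ord0 i) - a| : mR).
      apply: (measurableT_comp (@normr_measurable R setT)).
      exact: measurable_funB.
    by apply => //; exact: measurable_itv.
  have := measurable_box mA; congr measurable.
  apply/seteqP; split=> y /=; rewrite /rball/=.
    move=> H; split; first by rewrite invr_gt0.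
    by move=> i j; rewrite ord1; have := H j; rewrite /A/= in_itv/= !mxE.
  move=> [_ H] i; rewrite /A/= in_itv/=.
  by have := H ord0 i; rewrite !mxE.
have -> : [set y | O (Defs.point y)] =
    \bigcup_(q : 'rV[rat]_n * nat)
      (if `[< rball q `<=` O >] then [set y : n.-tuple mR | rball q (Defs.point y)] else set0).
  apply/seteqP; split=> y /=; last first.
    by move=> [q _]; case: ifPn => // /asboolP qO; exact: qO.
  move=> Oy; have /nbhs_ballP[e /= e0 eO] : nbhs (Defs.point y) O by exact: open_nbhs_nbhs.
  (* Half of [e]: the rational centre is within 1/(k+1) of the point, so the ball of that radius
     about the centre lies in the [e]-ball about the point. *)
  have [k ke] : exists k : nat, k.+1%:R^-1 < e / 2.
    exists (Num.truncn (e / 2)^-1).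
    by rewrite -[ltRHS]invrK ltf_pV2 ?posrE ?invr_gt0 ?divr_gt0// truncnS_gt.
  have /choice[q qP] : forall i : 'I_n, exists q : rat, `|ratr q - tnth y i| < (k.+1%:R^-1 : R).
    move=> i; have [] := @dense_rat R (ball (tnth y i : R) k.+1%:R^-1).
    - by exists (tnth y i); apply: ballxx; rewrite invr_gt0.
    - exact: ball_open.
    - by move=> x [+ [q _ qx]]; rewrite -qx => H; exists q; rewrite distrC.
  exists (\row_i q i, k) => //.
  case: ifPn => [_|/asboolPn []].
    split; first by rewrite invr_gt0.
    by move=> i j; rewrite ord1 /ball/= !mxE; exact: qP.
  move=> z [_ zq]; apply: eO; split => // i j.
  rewrite ord1 /ball /= !mxE.
  have := zq ord0 j; rewrite /ball/= !mxE => zqj.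
  rewrite (le_lt_trans (ler_distD (ratr (q j)) _ _))//.
  have := qP j; rewrite distrC => qj.
  by rewrite (splitr e) ltrD// (lt_trans _ ke).
apply: countable_bigcupT_measurable => //= q.
by case: ifPn.
Qed.

Lemma continuous_measurable_Rn f : continuous f -> measurable_Rn f.
Proof.
move=> cf _; apply: (measurability _ (RGenOInfty.measurableE R)) => //.
move=> _ [_ [a ->] <-]; rewrite setTI.
apply: (@measurable_point_open (f @^-1` `]a, +oo[)).
by move/continuousP : cf; apply; exact: interval_open.
Qed.

Lemma enorm_ge0 z : 0 <= enorm z.
Proof. exact: sqrtr_ge0. Qed.

Lemma enorm_sqr z : enorm z ^+ 2 = \sum_(i < n) z ord0 i ^+ 2.
Proof. by rewrite sqr_sqrtr// sumr_ge0// => i _; exact: sqr_ge0. Qed.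

Lemma enorm_coord z i : `|z ord0 i| <= enorm z.
Proof.
rewrite -sqrtr_sqr ler_wsqrtr// (bigD1 i)//= lerDl sumr_ge0// => j _.
exact: sqr_ge0.
Qed.

Lemma enormZ c z : enorm (c *: z) = `|c| * enorm z.
Proof.
rewrite /enorm -sqrtr_sqr -sqrtrM ?sqr_ge0// mulr_sumr; congr Num.sqrt.
by apply: eq_bigr => i _; rewrite mxE exprMn.
Qed.

Lemma enormN z : enorm (- z) = enorm z.
Proof. by rewrite -scaleN1r enormZ normrN1 mul1r. Qed.

Lemma enorm_eq0 z : enorm z = 0 -> z = 0.
Proof.
move=> z0; apply/rowP => i; rewrite mxE; apply/eqP; rewrite -normr_eq0 eq_le normr_ge0 andbT.
by rewrite -z0 enorm_coord.
Qed.

Lemma norm_le_enorm z : `|z| <= enorm z.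
Proof.
rewrite [leLHS]/Num.norm/= mx_normrE; apply/bigmax_leP; split; first exact: enorm_ge0.
by move=> [i j] _ /=; rewrite ord1 enorm_coord.
Qed.

Lemma measurable_enorm : measurable_Rn (@enorm R n).
Proof.
apply: (measurableT_comp (f := Num.sqrt : mR -> mR)).
  by apply: continuous_measurable_fun; exact: sqrt_continuous.
rewrite /=; apply: measurable_sum => i.
by apply: measurable_funX; exact: measurable_coord.
Qed.

(** On R^n functions are compared with the n-th power of this weight, so exponents are counted per
    coordinate: a decay |z|^(-n-2s) corresponds to be = 1 + 2s/n. *)
Definition radial_weight (al be r : R) : R := if r <= 1 then r `^ (- al) else r `^ (- be).

Lemma radial_weight_ge0 al be r : 0 <= radial_weight al be r.
Proof. by rewrite /radial_weight; case: ifP => _; exact: powR_ge0. Qed.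

(** Both branches decrease in r. In the mixed case |a| <= 1 < r the two sides are separated by 1,
    and at a = 0 the right side is infinite. *)
Lemma radial_weight_le_power_weight (al be r a : R) : 0 <= al -> 0 < be ->
  `|a| <= r -> ((radial_weight al be r)%:E <= power_weight al be a)%E.
Proof.
move=> al0 be0 ar; rewrite /power_weight; case: (eqVneq a 0) => [_|a0]; first exact: leey.
have na0 : 0 < `|a| by rewrite normr_gt0.
have powle p : 0 <= p -> r `^ (- p) <= `|a| `^ (- p).
  move=> p0; rewrite !powRN lef_pV2 ?posrE ?powR_gt0//; last exact: lt_le_trans ar.
  by apply: ge0_ler_powR => //; rewrite nnegrE (le_trans _ ar).
have p1 (c : R) : 1 `^ c = 1 by rewrite powR1.
rewrite /radial_weight; case: ifPn => [r1|].
  by rewrite (le_trans ar r1) lee_fin powle.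
rewrite -ltNge => r1; case: ifPn => [a1|_]; last by rewrite lee_fin powle// ltW.
rewrite lee_fin (@le_trans _ _ 1)//.
  rewrite powRN invf_le1 ?powR_gt0 ?(lt_trans ltr01)//.
  by rewrite -[leLHS](p1 be) ge0_ler_powR ?nnegrE ?(ltW be0) ?(ltW r1) ?(le_trans _ (ltW r1)).
rewrite powRN invf_ge1 ?powR_gt0//.
by rewrite -[leRHS](p1 al) ge0_ler_powR ?nnegrE.
Qed.

Lemma lee_prod (I : Type) (r : seq I) (F G : I -> \bar R) :
  (forall i, 0 <= F i <= G i)%E ->
  (\prod_(i <- r) F i <= \prod_(i <- r) G i)%E.
Proof.
move=> FG.
suff : (0 <= \prod_(i <- r) F i <= \prod_(i <- r) G i)%E by move=> /andP[].
elim/big_rec2 : _ => [|i x y _ /andP[y0 yx]]; first by rewrite lee01 lexx.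
have /andP[F0 FGi] := FG i.
by rewrite mule_ge0//= lee_pmul.
Qed.

(** The n factors of the radial weight are shared out among the n coordinates, one each, and Tonelli
    leaves a power of a finite one-dimensional integral. The admissible exponents, n al < n at the
    origin and n be > n at infinity, have the same strict bounds as in polar coordinates. *)
Lemma integrable_radial (al be C : R) f : 0 <= al < 1 -> 1 < be ->
  measurable_Rn f ->
  (forall z, `|f z| <= C * radial_weight al be (enorm z) ^+ n) -> integrable_Rn f.
Proof.
move=> /andP[al0 al1] be1 mf fle; apply/integrableP; split; first exact/measurable_EFinP.
have C0 : 0 <= `|C| by [].
have ipw := integral_power_weight al1 be1.
apply: (@le_lt_trans _ _ (\int[muN n]_y (`|C|%:E * \prod_(i < n) power_weight al be (tnth y i)))%E).
  have mp : measurable_fun setT (fun y : n.-tuple mR => \prod_(i < n) power_weight al be (tnth y i))%E.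
    by apply: measurable_prod_tuple; exact: measurable_power_weight.
  apply: ge0_le_integral => //.
  - by apply: measurableT_comp => //; exact/measurable_EFinP.
  - by apply: measurable_funeM.
  - move=> y _; rewrite /= (@le_trans _ _ ((`|C| * radial_weight al be (enorm (Defs.point y)) ^+ n)%:E))//.
      rewrite lee_fin (le_trans (fle _))// ler_wpM2r ?exprn_ge0 ?radial_weight_ge0//.
      exact: ler_norm.
    rewrite EFinM lee_wpmul2l ?lee_fin//.
    rewrite -[n in _ ^+ n]card_ord -prodr_const -prodEFin.
    apply: lee_prod => i.
    rewrite lee_fin radial_weight_ge0/= radial_weight_le_power_weight ?(lt_trans ltr01)//.
    by have := enorm_coord (Defs.point y) i; rewrite mxE.
have pw0 a : (0 <= power_weight al be a)%E by exact: power_weight_ge0.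
rewrite ge0_integralZl//; last 2 first.
- by apply: measurable_prod_tuple; exact: measurable_power_weight.
- by move=> y _; apply: prode_ge0.
rewrite ge0_integral_prod_tuple//; last exact: measurable_power_weight.
have fin : (\int[mu]_r power_weight al be r \is a fin_num)%E.
  by rewrite ge0_fin_numE// integral_ge0.
by rewrite -(fineK fin) prodEFin -EFinM ltry.
Qed.

End Rn_integration.

(** * Linearity and affine substitutions on R^n *)

Section Rn_change_of_variables.
Variables (R : realType) (n : nat).
Local Notation mR := (measurableTypeR R).
Local Notation muN := (lebesgue_Rn R).
Implicit Types (f g : 'rV[R]_n -> R) (z b : 'rV[R]_n) (c : R).

Lemma integral_RnE f : integral_Rn setT f = \int[muN n]_y f (Defs.point y).
Proof. by rewrite /integral_Rn preimage_setT. Qed.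

Lemma eq_integral_Rn f g : f =1 g -> integral_Rn setT f = integral_Rn setT g.
Proof. by move=> fg; rewrite !integral_RnE; apply: eq_Rintegral => y _. Qed.

Lemma eq_integrable_Rn f g : f =1 g -> integrable_Rn f -> integrable_Rn g.
Proof. by move=> /funext ->. Qed.

Lemma le_integrable_Rn f g : measurable_Rn f -> (forall z, `|f z| <= `|g z|) ->
  integrable_Rn g -> integrable_Rn f.
Proof.
move=> mf fg; apply: le_integrable => //; first exact/measurable_EFinP.
by move=> y _; rewrite /= lee_fin.
Qed.

Lemma integrable_RnD f g : integrable_Rn f -> integrable_Rn g ->
  integrable_Rn (fun z => f z + g z).
Proof.
move=> fi gi; rewrite /integrable_Rn.
exact: (@integrableD _ _ _ _ _ measurableT _ _ fi gi).
Qed.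

Lemma integrable_RnZ c f : integrable_Rn f -> integrable_Rn (fun z => c * f z).
Proof. by move=> fi; exact: (@integrableZl _ _ _ _ _ measurableT c _ fi). Qed.

Lemma integrable_RnB f g : integrable_Rn f -> integrable_Rn g ->
  integrable_Rn (fun z => f z - g z).
Proof.
by move=> fi gi; exact: (@integrableB _ _ _ _ _ measurableT _ _ fi gi).
Qed.

Lemma integral_RnD f g : integrable_Rn f -> integrable_Rn g ->
  integral_Rn setT (fun z => f z + g z) = integral_Rn setT f + integral_Rn setT g.
Proof. by move=> fi gi; rewrite !integral_RnE RintegralD. Qed.

Lemma integral_RnB f g : integrable_Rn f -> integrable_Rn g ->
  integral_Rn setT (fun z => f z - g z) = integral_Rn setT f - integral_Rn setT g.
Proof. by move=> fi gi; rewrite !integral_RnE RintegralB. Qed.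

Lemma integral_RnZ c f : integrable_Rn f ->
  integral_Rn setT (fun z => c * f z) = c * integral_Rn setT f.
Proof. by move=> fi; rewrite !integral_RnE RintegralZl. Qed.

Lemma integral_Rn_mkcond (D : set 'rV[R]_n) f :
  integral_Rn D f = integral_Rn setT (f \_ D).
Proof.
rewrite integral_RnE /integral_Rn Rintegral_mkcond.
by apply: eq_Rintegral => y _; rewrite !patchE.
Qed.

Lemma measurable_Rn_affine b c f : measurable_Rn f ->
  measurable_Rn (fun z => f (b + c *: z)).
Proof.
move=> mf; rewrite /measurable_Rn.
under eq_fun do rewrite -point_affine_tuple.
exact: (measurableT_comp mf (measurable_affine_tuple b c)).
Qed.

Let ge0_integral_affine_Rn b c f : c != 0 -> measurable_Rn f -> (forall z, 0 <= f z) ->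
  (\int[muN n]_y (f (Defs.point y))%:E =
   (`|c| ^+ n)%:E * \int[muN n]_y (f (b + c *: Defs.point y)%R)%:E)%E.
Proof.
move=> c0 mf f0.
rewrite (@ge0_integral_affine_tuple _ n b c (EFin \o (fun y => f (Defs.point y))))//.
- by under eq_integral do rewrite /= point_affine_tuple.
- exact/measurable_EFinP.
- by move=> y; rewrite /= lee_fin.
Qed.

Lemma integrable_Rn_affine b c f : c != 0 -> measurable_Rn f ->
  integrable_Rn (fun z => f (b + c *: z)) <-> integrable_Rn f.
Proof.
move=> c0 mf.
have mn : measurable_Rn (fun z => `|f z|).
  exact: (measurableT_comp (@normr_measurable R setT) mf).
have E := @ge0_integral_affine_Rn b c _ c0 mn (fun z => normr_ge0 _).
have cn : 0 < `|c| ^+ n by rewrite exprn_gt0// normr_gt0.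
split=> /integrableP[mi fi]; apply/integrableP; split.
- exact/measurable_EFinP.
- rewrite -ge0_fin_numE; last by apply: integral_ge0 => ? _.
  rewrite [X in X \is a _]E fin_numM// ge0_fin_numE//; by apply: integral_ge0 => ? _; rewrite lee_fin.
- by apply/measurable_EFinP; exact: measurable_Rn_affine.
- have : (\int[muN n]_y (`|f (Defs.point y)|%R)%:E < +oo)%E by [].
  rewrite E; apply: contraTT; rewrite -leNgt leye_eq => /eqP H.
  rewrite -leNgt leye_eq; apply/eqP.
  have -> : (\int[muN n]_y (`|f (b + c *: Defs.point y)|)%:E = +oo)%E by exact: H.
  by rewrite mulry gtr0_sg ?mul1e.
Qed.

Lemma integral_Rn_affine b c f : c != 0 -> integrable_Rn f ->
  integral_Rn setT f = `|c| ^+ n * integral_Rn setT (fun z => f (b + c *: z)).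
Proof.
move=> c0 fi.
have mf := integrable_Rn_measurable fi.
have fi' : integrable_Rn (fun z => f (b + c *: z)) by apply/integrable_Rn_affine.
rewrite !integral_RnE /Rintegral.
rewrite -[RHS]/(fine (`|c| ^+ n)%:E * _) -fineM//; last first.
  exact: integrable_fin_num fi'.
congr fine.
have fp g y : (EFin \o (fun y => g (Defs.point y)))^\+%E y = (Num.max (g (Defs.point y)) 0)%:E.
  by rewrite funeposE/= EFin_max.
have fn g y : (EFin \o (fun y => g (Defs.point y)))^\-%E y = (Num.max (- g (Defs.point y)) 0)%:E.
  by rewrite funenegE/= EFin_max.
rewrite [LHS]integralE [X in _ = (_ * X)%E]integralE muleBr//; last first.
  exact: (@integrable_add_def _ _ _ (muN n) _ measurableT _ fi').
congr (_ - _)%E.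
- under eq_integral do rewrite fp.
  under [in RHS]eq_integral do rewrite (fp (fun z => f (b + c *: z))).
  apply: (@ge0_integral_affine_Rn b c (fun z => Num.max (f z) 0)) => //.
    by apply: measurable_maxr => //; exact: measurable_cst.
  by move=> z; rewrite le_max lexx orbT.
- under eq_integral do rewrite fn.
  under [in RHS]eq_integral do rewrite (fn (fun z => f (b + c *: z))).
  apply: (@ge0_integral_affine_Rn b c (fun z => Num.max (- f z) 0)) => //.
    by apply: measurable_maxr => //; exact: measurable_funN.
  by move=> z; rewrite le_max lexx orbT.
Qed.

Lemma integral_Rn_opp f : integrable_Rn f ->
  integral_Rn setT f = integral_Rn setT (fun z => f (- z)).
Proof.
move=> fi; rewrite (@integral_Rn_affine 0 (-1))// ?oppr_eq0 ?oner_eq0//.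
rewrite normrN1 expr1n mul1r; apply: eq_integral_Rn => z.
by rewrite add0r scaleN1r.
Qed.

Lemma integral_Rn_shift b f : integrable_Rn f ->
  integral_Rn setT f = integral_Rn setT (fun z => f (b + z)).
Proof.
move=> fi; rewrite (@integral_Rn_affine b 1)// ?oner_eq0//.
rewrite normr1 expr1n mul1r; apply: eq_integral_Rn => z.
by rewrite scale1r.
Qed.

End Rn_change_of_variables.

(** * The Gamma function *)

Section positive_integral.
Context d (T : measurableType d) (R : realType) (mu : {measure set T -> \bar R}).

(** If the integral vanished, f would be zero almost everywhere, whereas it is positive on a set of
    nonzero measure. This gives the positivity of Gamma and of the Poisson constant. *)
Lemma integral_gt0 (D : set T) (f : T -> \bar R) : measurable D ->
  mu D != 0%E -> measurable_fun D f -> (forall x, D x -> (0 < f x)%E) ->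
  (0 < \int[mu]_(x in D) f x)%E.
Proof.
move=> mD muD mf f0.
have i0 : (0 <= \int[mu]_(x in D) f x)%E by apply: integral_ge0 => x /f0/ltW.
rewrite lt_neqAle i0 andbT; apply/negP => /eqP/esym i00.
have /(ae_eq_integral_abs mu mD mf)[N [mN N0 sub]] : (\int[mu]_(x in D) `|f x| = 0)%E.
  rewrite -i00; apply: eq_integral => x; rewrite inE => /f0 fx.
  by rewrite gee0_abs// ltW.
move/eqP: muD; apply; apply: (@subset_measure0 _ _ _ mu _ N) => //.
move=> x Dx; apply: sub => /= /(_ Dx) fx.
by have := f0 _ Dx; rewrite fx ltxx.
Qed.

End positive_integral.

(** * Absorbing logarithms and exponentials into powers *)

Section log_power_bounds.
Variable R : realType.
Implicit Types x e p : R.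

(** Apply ln y <= y to y = x^e and to y = x^(-e). Every logarithmic integrand in the proof is
    dominated through this inequality. *)
Lemma normr_ln_le e x : 0 < e -> 0 < x -> `|ln x| <= e^-1 * (x `^ e + x `^ (- e)).
Proof.
move=> e0 x0; rewrite mulrC ler_pdivlMr// mulrC.
have h (y : R) : 0 < y -> ln y <= y by move=> y0; rewrite ltW// ln_sublinear.
have h1 := h _ (powR_gt0 e x0); have h2 := h _ (powR_gt0 (- e) x0).
rewrite !ln_powR in h1 h2.
have p1 := powR_ge0 x e; have p2 := powR_ge0 x (- e).
rewrite -[X in X * _](gtr0_norm e0) -normrM ler_norml; apply/andP; split; lra.
Qed.

Lemma ler_powRN x (p q : R) : 0 < x <= 1 -> p <= q -> x `^ (- p) <= x `^ (- q).
Proof. by move=> x1 pq; apply: ger_powR => //; rewrite lerN2. Qed.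

(** Raise expR (x/m) >= x/m to the power m. *)
Lemma expRN_le_powR m x : 0 < m -> 0 < x -> expR (- x) <= m `^ m * x `^ (- m).
Proof.
move=> m0 x0.
rewrite expRN powRN ler_pdivlMr ?powR_gt0// mulrC ler_pdivrMr ?expR_gt0//.
have -> : expR x = (expR (x / m)) `^ m.
  by rewrite -expRM mulfVK// gt_eqF.
rewrite -powRM ?expR_ge0 ?(ltW m0)//.
have m0' := ltW m0; have x0' := ltW x0.
apply: ge0_ler_powR; rewrite ?nnegrE ?mulr_ge0 ?expR_ge0//.
rewrite mulrC -ler_pdivrMr// ltW//.
by rewrite (lt_le_trans _ (expR_ge1Dx _))// ltrDr.
Qed.

Lemma is_derive_powRr (a p : R) : 0 < a -> is_derive p 1 (fun p => a `^ p) (ln a * a `^ p).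
Proof.
move=> a0.
have -> : (fun p => a `^ p) = (fun p => expR (p * ln a)).
  by apply/funext => q; rewrite /powR gt_eqF.
apply: is_derive_eq.
by rewrite /GRing.scale/= /powR gt_eqF//; ring.
Qed.

End log_power_bounds.

Section Gamma_regularity.
Variable R : realType.
Local Notation mR := (measurableTypeR R).
Local Notation mu := (@lebesgue_measure R).
Local Notation J := (`]0, +oo[%classic : set mR).

Lemma measurable_radial_weight al be : measurable_fun setT (radial_weight al be : mR -> mR).
Proof.
apply: measurable_fun_ifT; [|exact: measurable_powR..].
exact: measurable_fun_ler.
Qed.

Lemma integrable_radial_weight (al be C : R) : al < 1 -> 1 < be ->
  mu.-integrable J (EFin \o (fun t : mR => C * radial_weight al be t)).
Proof.
move=> al1 be1.
suff H : mu.-integrable J (EFin \o (radial_weight al be : mR -> mR)).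
  exact: (@integrableZl _ _ _ mu _ _ C _ H).
apply/integrableP; split.
  by apply/measurable_EFinP; apply: measurable_funTS; exact: measurable_radial_weight.
have P := integral_power_weight_pos al1 be1.
rewrite (@eq_integral _ mR R mu J (power_weight al be))// => t; rewrite inE/= in_itv/= andbT => t0.
by rewrite power_weight_posE// ger0_norm// radial_weight_ge0.
Qed.

Let g (a : R) (t : mR) : R := t `^ (a - 1) * expR (- t).

Let mg a : measurable_fun setT (g a).
Proof.
apply: measurable_funM; first exact: measurable_powR.
by apply: measurableT_comp => //; exact: measurable_expR.
Qed.

(** One dominator for all a in [a1, a2], for the Gamma integrand and for its derivative in a. Near 0
    the logarithm costs t^(-a1/2), half of the margin that t^(a1-1) has over t^(-1). For t > 1 the
    bound is proved for t g(a,t), and ln t <= t spends the extra factor. *)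
Let g_bound (a1 a2 : R) : 0 < a1 -> a1 <= a2 -> exists C : R, forall (a : R) t, a1 <= a <= a2 ->
  0 < t -> `|g a t| <= C * radial_weight (1 - a1 / 2) 2 t /\
  `|ln t * g a t| <= C * radial_weight (1 - a1 / 2) 2 t.
Proof.
move=> a10 a12.
(* Chosen so that t^a2 t^(-m) = t^(-2). *)
pose m := a2 + 2.
have m0 : 0 < m by rewrite /m; lra.
(* The three terms serve, in order, the integrand near 0, its product with ln t near 0, and both of
   them for t > 1. *)
exists (1 + 4 / a1 + m `^ m) => a t /andP[a1a aa2] t0.
have g0 : 0 <= g a t by rewrite mulr_ge0 ?powR_ge0 ?expR_ge0.
rewrite (normrM (ln t)) !(ger0_norm g0) /radial_weight.
have mm0 : 0 < m `^ m by rewrite powR_gt0.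
have a40 : 0 < 4 / a1 by rewrite divr_gt0.
case: ifPn => [t1|].
  have gle : g a t <= t `^ (a1 - 1).
    rewrite /g -[leRHS]mulr1 ler_pM ?powR_ge0 ?expR_ge0//.
      by apply: ger_powR; rewrite ?t0//; lra.
    by rewrite -expR0 ler_expR; lra.
  have pw : t `^ (a1 - 1) <= t `^ (- (1 - a1 / 2)).
    by apply: ger_powR; rewrite ?t0//; lra.
  have pw0 : 0 <= t `^ (- (1 - a1 / 2)) by exact: powR_ge0.
  split; first by rewrite (le_trans gle)// (le_trans pw)// ler_peMl//; lra.
  have lnt : `|ln t| <= 4 / a1 * t `^ (- (a1 / 2)).
    have a20 : 0 < a1 / 2 by lra.
    rewrite (le_trans (normr_ln_le a20 t0))//.
    rewrite (_ : 4 / a1 = (a1 / 2)^-1 * 2); last by field; lra.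
    rewrite -mulrA ler_wpM2l ?invr_ge0 ?(ltW a20)//.
    have : t `^ (a1 / 2) <= t `^ (- (a1 / 2)) by apply: ger_powR; rewrite ?t0//; lra.
    by lra.
  rewrite (le_trans (ler_pM _ _ lnt gle))//.
  rewrite -(mulrA (4 / a1)) -powRD; last by rewrite (gt_eqF t0) implybT.
  rewrite (_ : - (a1 / 2) + (a1 - 1) = - (1 - a1 / 2)); last by field.
  by rewrite ler_wpM2r//; lra.
rewrite -ltNge => t1.
have gle : g a t * t <= m `^ m * t `^ (- 2).
  have et := expRN_le_powR m0 t0.
  rewrite /g mulrAC (@le_trans _ _ (t `^ a2 * (m `^ m * t `^ (- m))))//.
    rewrite ler_pM ?mulr_ge0 ?powR_ge0 ?expR_ge0 ?(ltW t0)//.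
    rewrite -[X in _ * X](powRr1 (ltW t0)) -powRD ?(gt_eqF t0) ?implybT//.
    by apply: ler_powR; [exact: ltW|lra].
  rewrite mulrCA -powRD ?(gt_eqF t0) ?implybT//.
  by rewrite (_ : a2 - m = - 2)// /m; lra.
have t20 : 0 <= t `^ (- 2) by exact: powR_ge0.
have gle' : g a t * t <= (1 + 4 / a1 + m `^ m) * t `^ (- 2).
  by rewrite (le_trans gle)// ler_wpM2r//; lra.
split.
  by rewrite (le_trans _ gle')// ler_peMr// ltW.
rewrite (le_trans _ gle')// mulrC ler_wpM2l// ger0_norm; last by rewrite ln_ge0// ltW.
by rewrite ltW// ln_sublinear.
Qed.

Let ig a : 0 < a -> mu.-integrable J (EFin \o g a).
Proof.
move=> a0; have [C H] := g_bound a0 (lexx a).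
have al1 : 1 - a / 2 < 1 by lra.
apply: le_integrable (@integrable_radial_weight _ 2 C al1 _) => //.
- by apply/measurable_EFinP; apply: measurable_funTS.
- move=> t; rewrite /= in_itv/= andbT => t0; rewrite lee_fin.
  have [] := H a t _ t0; first by rewrite lexx.
  by move=> + _ => /le_trans; apply; exact: ler_norm.
- by rewrite ltr1n.
Qed.

Lemma Gamma_gt0 (a : R) : 0 < a -> 0 < Gamma a.
Proof.
move=> a0; rewrite /Gamma /Rintegral -lte_fin fineK; last exact: integrable_fin_num (ig a0).
apply: integral_gt0 => //.
- by have := @lebesgue_measure_itv R `]0, +oo[; rewrite /= ltry => ->.
- by apply/measurable_EFinP; apply: measurable_funTS; exact: mg.
- move=> t; rewrite /= in_itv/= andbT => t0.
  by rewrite lte_fin mulr_gt0 ?powR_gt0 ?expR_gt0.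
Qed.

Lemma derivable_Gamma (a : R) : 0 < a -> derivable (@Gamma R) a 1.
Proof.
move=> a0.
have a120 : 0 < a / 2 by lra.
have a12 : a / 2 <= 2 * a by lra.
have [C H] := g_bound a120 a12.
have C0 t : 0 < t -> 0 <= C * radial_weight (1 - (a / 2) / 2) 2 t.
  move=> t0; have [] := H (a / 2) t _ t0; first by rewrite lexx.
  by move=> + _ => /(le_trans _); apply.
have Dg (t x : R) : 0 < t -> is_derive x 1 (g ^~ t) (ln t * g x t).
  move=> t0.
  have h : is_derive x 1 (fun p => t `^ (p - 1)) (ln t * t `^ (x - 1)).
    have D1 := is_derive_powRr (x - 1) t0.
    have D2 : is_derive x 1 (fun p : R => p - 1) 1 by apply: is_derive_eq; rewrite subr0.
    have := @is_derive1_comp _ (fun p => t `^ p) (fun p => p - 1) x _ _ D1 D2.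
    by rewrite /GRing.scale/= mulr1.
  rewrite /g; apply: is_derive_eq.
  by rewrite scaler0 add0r /GRing.scale/=; ring.
(* The window ]a/2, 2a[ stays away from 0, so a single dominator works on it. The absolute value
   makes that dominator nonnegative also outside the domain of integration. *)
apply: (@derivable_under_integral _ _ _ mu g J _ a (a / 2) (2 * a) _ _ _
  (fun t => `|C * radial_weight (1 - (a / 2) / 2) 2 t|)) => //.
- by rewrite /= in_itv/=; apply/andP; split; lra.
- move=> x; rewrite /= in_itv/= => /andP[x1 _]; apply: ig; lra.
- move=> x t _; rewrite /= in_itv/= andbT => t0.
  by have [] := Dg t x t0.
- apply: (@integrable_norm _ _ _ mu _ _ ).
  apply: integrable_radial_weight; lra.
- move=> x t; rewrite /= !in_itv/= andbT => /andP[x1 x2] t0.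
  rewrite partial1of2E; have [_ ->] := Dg t x t0.
  rewrite [leRHS]ger0_norm; last exact: C0.
  by have [] := H x t _ t0 => //; lra.
Qed.

End Gamma_regularity.

(** * Second differences *)

Section directional_derivatives.
Variables (R : realType) (V : normedModType R).
Implicit Types (f : V -> R) (x v : V).

(** The two difference quotients are the same function of k. This carries one-variable results, the
    mean value theorem and differentiation under the integral, over to directional derivatives. *)
Lemma is_derive_line f x v (h d : R) :
  is_derive h 1 (fun k => f (x + k *: v)) d <-> is_derive (x + h *: v) v f d.
Proof.
have E : (fun k : R => k^-1 *: (((fun k => f (x + k *: v)) \o shift h) (k *: 1) - f (x + h *: v))) =
    (fun k : R => k^-1 *: ((f \o shift (x + h *: v)) (k *: v) - f (x + h *: v))).
  apply/funext => k /=; congr (_ *: (f _ - _)).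
  have -> : k *: (1 : R) = k by exact: mulr1.
  by rewrite scalerDl addrCA.
split=> -[D1 D2]; split.
- by rewrite /derivable -E.
- by rewrite -D2 /derive -E.
- by rewrite /derivable E.
- by rewrite -D2 /derive E.
Qed.

End directional_derivatives.

Section second_difference.
Variables (R : realType) (n : nat) (u : 'rV[R]_n -> R).
Hypotheses (hu : smooth u) (hc : compactly_supported u).
Implicit Types (x z : 'rV[R]_n).

Lemma smooth_continuous : continuous u.
Proof. by have [/(_ _)/differentiable_continuous] := hu 1. Qed.

Lemma compactly_supported_bounded : exists2 M, 0 <= M & forall z, `|u z| <= M.
Proof.
have cu : compact (u @` closure [set x | u x != 0]).
  by apply: continuous_compact hc; apply: continuous_subspaceT; exact: smooth_continuous.
have [M [_ HM]] := compact_bounded cu.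
exists (`|M| + 1) => // z.
have [->|uz] := eqVneq (u z) 0; first by rewrite normr0.
apply: (HM (`|M| + 1)); first by rewrite (le_lt_trans (ler_norm M))// ltrDl.
by exists z => //; exact: subset_closure.
Qed.

Lemma compactly_supported_outside : exists2 M, 0 <= M & forall z i, M < `|z ord0 i| -> u z = 0.
Proof.
have [M [_ HM]] := compact_bounded hc.
exists (`|M| + 1) => // z i; apply: contraTeq => uz; rewrite -leNgt.
apply: (@le_trans _ _ `|z|).
  rewrite [leRHS]/Num.norm/= mx_normrE.
  by apply/bigmax_geP; right; exists (ord0, i).
apply: (HM (`|M| + 1)); first by rewrite (le_lt_trans (ler_norm M))// ltrDl.
exact: subset_closure.
Qed.

Let e (i : 'I_n) : 'rV[R]_n := delta_mx ord0 i.

Lemma derive_coord (f : 'rV[R]_n -> R) x z : differentiable f x ->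
  'D_z f x = \sum_(i < n) z ord0 i * 'D_(e i) f x.
Proof.
move=> df; rewrite deriveE// {1}(row_sum_delta z) linear_sum/=.
by apply: eq_bigr => i _; rewrite linearZ/= deriveE.
Qed.

Let df1 x : differentiable u x. Proof. by have [] := hu 1. Qed.
Let df2 v x : differentiable ('D_v u) x.
Proof. by have [_ /(_ v)[]] := hu 2. Qed.
Let df3 v w x : differentiable ('D_w ('D_v u)) x.
Proof. by have [_ /(_ v)[_ /(_ w)[]]] := hu 3. Qed.

Lemma derive2_coord x z :
  'D_z ('D_z u) x = \sum_(i < n) z ord0 i * \sum_(j < n) z ord0 j * 'D_(e j) ('D_(e i) u) x.
Proof.
have -> : 'D_z u = \sum_(i < n) (z ord0 i \*: 'D_(e i) u).
  apply/funext => y; rewrite derive_coord// fct_sumE.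
  by apply: eq_bigr => i _.
rewrite derive_sum; last first.
  by move=> i; apply: derivableZ; exact: diff_derivable.
apply: eq_bigr => i _.
rewrite deriveZ; last exact: diff_derivable.
by rewrite (derive_coord z (df2 (e i) x)).
Qed.

(** The sum [F] of the absolute values of all second partials is continuous, so it is at most F(x) +
    1 near x. With |z_i| <= |z| this bounds the Hessian form with one constant for all
    directions. *)
Lemma derive2_local_bound x : exists2 C, 0 <= C & exists2 del, 0 < del &
  forall y z, `|y - x| < del -> `|'D_z ('D_z u) y| <= C * enorm z ^+ 2.
Proof.
pose F y := \sum_(i < n) \sum_(j < n) `|'D_(e j) ('D_(e i) u) y|.
have cF : {for x, continuous F}.
  apply: cvg_big; [exact: add_continuous|exact: nbhs_filter|move=> i _].
  apply: cvg_big; [exact: add_continuous|exact: nbhs_filter|move=> j _].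
  apply: cvg_norm; first exact: nbhs_filter.
  exact: (differentiable_continuous (df3 (e i) (e j) x)).
have F0 y : 0 <= F y by apply: sumr_ge0 => i _; apply: sumr_ge0.
have /cvgrPdist_lt /(_ 1 ltr01) /nbhs_ballP[del /= del0 Hdel] := cF.
exists (F x + 1); first by rewrite addr_ge0.
exists del => // y z yx.
have Fy : F y <= F x + 1.
  have := Hdel y; rewrite -ball_normE/= distrC => /(_ yx).
  by rewrite distrC => /ltW; rewrite ler_distl => /andP[_].
rewrite derive2_coord (le_trans (ler_norm_sum _ _ _))//.
apply: (@le_trans _ _ (F y * enorm z ^+ 2)); last by rewrite ler_wpM2r// exprn_ge0// enorm_ge0.
rewrite mulr_suml; apply: ler_sum => i _.
rewrite normrM mulrC mulr_suml.
rewrite (le_trans (ler_wpM2r _ (ler_norm_sum _ _ _)))// mulr_suml.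
apply: ler_sum => j _; rewrite normrM mulrC mulrA mulrC.
rewrite ler_wpM2l// expr2 ler_pM// ?enorm_coord//.
Qed.

Lemma second_difference_bound x : exists2 C, 0 <= C & forall z,
  `|2 * u x - u (x + z) - u (x - z)| <= C * Num.min 1 (enorm z ^+ 2).
Proof.
have [C C0 [del del0 H]] := derive2_local_bound x.
have [M M0 HM] := compactly_supported_bounded.
(* One term per regime: 4M for |z| >= 1, 4M/del^2 for del <= |z| < 1, and 2C for |z| < del. *)
pose K := 4 * M + 2 * C + 4 * M / del ^+ 2.
have d20 : 0 < del ^+ 2 by rewrite exprn_gt0.
have Md : 0 <= 4 * M / del ^+ 2 by apply: divr_ge0; [exact: mulr_ge0|exact: ltW].
exists K => [|z]; first by rewrite /K; lra.
have Dle : `|2 * u x - u (x + z) - u (x - z)| <= 4 * M.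
  rewrite (le_trans (ler_normB _ _))// (_ : 4 * M = 2 * M + M + M); last by ring.
  rewrite lerD// (le_trans (ler_normB _ _))// lerD// normrM ger0_norm//.
  by rewrite ler_wpM2l.
have [z1|z1] := leP 1 (enorm z ^+ 2).
  by rewrite mulr1 (le_trans Dle)// /K; lra.
have [zd|zd] := leP del (enorm z).
  have : del ^+ 2 <= enorm z ^+ 2 by rewrite ler_pXn2r ?nnegrE ?enorm_ge0 ?(ltW del0).
  move=> dz; rewrite (le_trans Dle)// (@le_trans _ _ (4 * M / del ^+ 2 * enorm z ^+ 2))//.
    by rewrite mulrAC ler_pdivlMr// ler_wpM2l// mulr_ge0.
  by rewrite ler_wpM2r ?exprn_ge0 ?enorm_ge0// /K; lra.
(* For small z the mean value theorem is used twice. It gives phi(1) - phi(0) = psi(-c) - psi(c)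
   with 0 < c < 1, and then -2c psi'(d) with |d| < c. So the segment from x - z to x + z is all that
   matters, and it lies in the ball of radius [del]. *)
pose psi (h : R) := 'D_z u (x + h *: z).
pose phi (h : R) := 2 * u x - u (x + h *: z) - u (x + h *: (- z)).
have Dpsi (h : R) : is_derive h 1 psi ('D_z ('D_z u) (x + h *: z)).
  have L : derivable ('D_z u) (x + h *: z) z by apply: diff_derivable; exact: df2.
  exact: ((is_derive_line ('D_z u) x z h _).2 (derivableP L)).
have Du (h : R) w : is_derive h 1 (fun k => u (x + k *: w)) ('D_w u (x + h *: w)).
  have L : derivable u (x + h *: w) w by apply: diff_derivable; exact: df1.
  exact: ((is_derive_line u x w h _).2 (derivableP L)).
have DN h : 'D_(- z) u (x + h *: (- z)) = - psi (- h).
  rewrite /psi scalerN -scaleNr !deriveE// linearN//.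
have Dphi (h : R) : is_derive h 1 phi (psi (- h) - psi h).
  have D1 := Du h z; have D2 := Du h (- z).
  apply: is_derive_eq.
  by rewrite DN -/(psi h); ring.
have cont (f df : R -> R) (a b : R) : (forall h : R, is_derive h 1 f (df h)) ->
    {within `[a, b], continuous f}.
  move=> Hf; apply: continuous_subspaceT => h.
  apply: differentiable_continuous; apply/derivable1_diffP.
  by have [] := Hf h.
have [c /[!in_itv]/= /andP[c0 c1] Ec] := @MVT R phi _ 0 1 ltr01 (fun h _ => Dphi h) (cont _ _ _ _ Dphi).
have phi0 : phi 0 = 0 by rewrite /phi !scale0r !addr0; ring.
have phi1 : phi 1 = 2 * u x - u (x + z) - u (x - z) by rewrite /phi !scale1r.
rewrite phi0 subr0 subr0 mulr1 phi1 in Ec.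
have cc : - c < c by lra.
have [d /[!in_itv]/= /andP[dc0 dc1] Ed] := @MVT R psi _ (- c) c cc (fun h _ => Dpsi h) (cont _ _ _ _ Dpsi).
rewrite Ec -opprB Ed normrN normrM opprK.
have nd : `|d| <= 1 by rewrite ler_norml; apply/andP; split; lra.
have := H (x + d *: z) z; rewrite addrAC subrr add0r.
move=> /(_ _)/(le_trans _) Hd.
have ndz : `|d *: z| < del.
  rewrite normrZ (le_lt_trans _ zd)// (le_trans _ (norm_le_enorm z))//.
  by rewrite ler_piMl.
rewrite (@le_trans _ _ (C * enorm z ^+ 2 * 2))//.
  by rewrite ler_pM ?Hd// ger0_norm; lra.
rewrite mulrAC ler_wpM2r ?exprn_ge0 ?enorm_ge0// /K; lra.
Qed.

End second_difference.

(** * Poisson and Riesz kernels *)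

Section kernels.
Variables (R : realType) (n : nat).
Hypothesis n0 : (0 < n)%N.
Local Notation mR := (measurableTypeR R).
Local Notation muN := (lebesgue_Rn R).
Implicit Types (f g k : 'rV[R]_n -> R) (x z : 'rV[R]_n) (s t : R).

Let nR : (0 : R) < n%:R. Proof. by rewrite ltr0n. Qed.

Lemma powR_exprn (a p : R) m : (a `^ p) ^+ m = a `^ (p * m%:R).
Proof. by rewrite -powR_mulrn ?powR_ge0// -powRrM. Qed.

Lemma sqr_powR (a p : R) : 0 <= a -> (a ^+ 2) `^ p = a `^ (2 * p).
Proof. by move=> a0; rewrite -powR_mulrn// -powRrM. Qed.

Lemma integrable_bessel (C s : R) f : 0 < s -> measurable_Rn f ->
  (forall z, `|f z| <= C * (enorm z ^+ 2 + 1) `^ (- ((n%:R + 2 * s) / 2))) ->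
  integrable_Rn f.
Proof.
move=> s0 mf fle.
have be1 : 1 < 1 + 2 * s / n%:R by rewrite ltrDl divr_gt0// mulr_gt0.
apply: (@integrable_radial _ _ 0 (1 + 2 * s / n%:R) C) => // [|z].
  by rewrite lexx ltr01.
have z0 := enorm_ge0 z; have z20 : 0 <= enorm z ^+ 2 by rewrite exprn_ge0.
have C0 : 0 <= C.
  have := le_trans (normr_ge0 _) (fle z); rewrite pmulr_lge0// powR_gt0//; lra.
have a0 : 0 <= (n%:R + 2 * s) / 2 by rewrite divr_ge0// addr_ge0 ?mulr_ge0// ltW.
rewrite (le_trans (fle z))// ler_wpM2l//.
have q0 : 0 < enorm z ^+ 2 + 1 by lra.
rewrite /radial_weight; case: ifPn => [z1|].
  rewrite oppr0 powRr0 expr1n powRN invf_le1 ?powR_gt0//.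
  by rewrite -{1}(powRr0 (enorm z ^+ 2 + 1)) ler_powR//; lra.
rewrite -ltNge => z1; rewrite powR_exprn.
have -> : - (1 + 2 * s / n%:R) * n%:R = 2 * - ((n%:R + 2 * s) / 2).
  by field; rewrite gt_eqF.
rewrite -sqr_powR// !powRN lef_pV2 ?posrE ?powR_gt0// ?exprn_gt0 ?(lt_trans ltr01)//.
by rewrite ge0_ler_powR ?nnegrE ?(ltW q0)//; lra.
Qed.

Lemma integrable_riesz (C s : R) f : 0 < s < 1 -> measurable_Rn f ->
  (forall z, `|f z| <= C * Num.min 1 (enorm z ^+ 2) * enorm z `^ (- (n%:R + 2 * s))) ->
  integrable_Rn f.
Proof.
move=> /andP[s0 s1] mf fle.
have be1 : 1 < 1 + 2 * s / n%:R by rewrite ltrDl divr_gt0// mulr_gt0.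
(* Near 0 the bound behaves like |z|^(-(n+2s-2)), and al < 1 is precisely s < 1. The maximum with 0
   covers n = 1, s < 1/2, where this exponent per coordinate is negative. *)
pose al := Num.max 0 ((n%:R + 2 * s - 2) / n%:R).
have al0 : 0 <= al by rewrite le_max lexx.
have aln : n%:R + 2 * s - 2 <= al * n%:R by rewrite -ler_pdivrMr// le_max lexx orbT.
apply: (@integrable_radial _ _ al (1 + 2 * s / n%:R) `|C|) => // [|z].
  by rewrite al0/= gt_max ltr01/= ltr_pdivrMr//; lra.
have z0 := enorm_ge0 z; have z20 : 0 <= enorm z ^+ 2 by rewrite exprn_ge0.
have m0 : 0 <= Num.min 1 (enorm z ^+ 2) by rewrite le_min ler01.
rewrite (le_trans (fle z))// -mulrA.
rewrite (@le_trans _ _ (`|C| * (Num.min 1 (enorm z ^+ 2) * enorm z `^ (- (n%:R + 2 * s)))))//.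
  by rewrite ler_wpM2r ?ler_norm// mulr_ge0 ?powR_ge0.
rewrite ler_wpM2l// /radial_weight; case: ifPn => [z1|].
  have [zE|zne] := eqVneq (enorm z) 0.
    rewrite zE expr0n/= (_ : Num.min 1 0 = 0 :> R) ?mul0r ?exprn_ge0 ?powR_ge0//.
    by apply/min_idPr.
  have zgt : 0 < enorm z by rewrite lt_neqAle eq_sym zne.
  rewrite (@le_trans _ _ (enorm z ^+ 2 * enorm z `^ (- (n%:R + 2 * s))))//.
    by rewrite ler_wpM2r ?powR_ge0// ge_min lexx orbT.
  rewrite powR_exprn -powR_mulrn// -powRD ?(gt_eqF zgt) ?implybT//.
  by apply: ger_powR; [rewrite zgt|move: aln; lra].
rewrite -ltNge => z1; rewrite powR_exprn.
have -> : - (1 + 2 * s / n%:R) * n%:R = - (n%:R + 2 * s).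
  by field; rewrite gt_eqF.
by rewrite ler_piMl ?powR_ge0// ge_min lexx.
Qed.

Lemma measurable_bessel (t p : R) : measurable_Rn (fun z => (enorm z ^+ 2 + t) `^ p).
Proof.
apply: (measurableT_comp (@measurable_powR R p)).
apply: measurable_funD => //; apply: measurable_funX; exact: measurable_enorm.
Qed.

Lemma measurable_ln_bessel (t : R) : measurable_Rn (fun z => ln (enorm z ^+ 2 + t)).
Proof.
apply: (measurableT_comp (@measurable_ln R)).
apply: measurable_funD => //; apply: measurable_funX; exact: measurable_enorm.
Qed.

Let a s := (n%:R + 2 * s) / 2.

Lemma integrable_poisson1 s : 0 < s ->
  integrable_Rn (fun z => (enorm z ^+ 2 + 1) `^ (- a s)).
Proof.
move=> s0; apply: (@integrable_bessel 1 s) => // [|z]; first exact: measurable_bessel.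
by rewrite mul1r ger0_norm// powR_ge0.
Qed.

Lemma integrable_poisson1_log s : 0 < s ->
  integrable_Rn (fun z => ln (enorm z ^+ 2 + 1) * (enorm z ^+ 2 + 1) `^ (- a s)).
Proof.
move=> s0.
(* The logarithm is paid for with half of the decay: the remaining kernel is the Poisson kernel of
   order s/2. *)
have s20 : 0 < s / 2 by lra.
apply: (@integrable_bessel (2 * (s / 2)^-1) (s / 2)) => // [|z].
  by apply: measurable_funM; [exact: measurable_ln_bessel|exact: measurable_bessel].
have z20 : 0 <= enorm z ^+ 2 by rewrite exprn_ge0// enorm_ge0.
have q0 : 0 < enorm z ^+ 2 + 1 by lra.
have q1 : 1 <= enorm z ^+ 2 + 1 by lra.
rewrite normrM (ger0_norm (powR_ge0 _ _)).
have L := normr_ln_le s20 q0.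
have P : (enorm z ^+ 2 + 1) `^ (- (s / 2)) <= (enorm z ^+ 2 + 1) `^ (s / 2).
  by apply: ler_powR => //; lra.
rewrite (@le_trans _ _ (2 * (s / 2)^-1 * (enorm z ^+ 2 + 1) `^ (s / 2) * (enorm z ^+ 2 + 1) `^ (- a s)))//.
  rewrite ler_wpM2r ?powR_ge0// (le_trans L)// (mulrC 2) -mulrA ler_wpM2l ?invr_ge0 ?(ltW s20)//.
  by lra.
rewrite -(mulrA (2 * _)) -powRD ?(gt_eqF q0) ?implybT//.
by rewrite (_ : s / 2 + - a s = - ((n%:R + 2 * (s / 2)) / 2))// /a; lra.
Qed.

(* z = t * zeta turns the kernel at height t into the one at height 1 *)
Let scale_q t z : 0 < t -> enorm (0 + t *: z) ^+ 2 + t ^+ 2 = t ^+ 2 * (enorm z ^+ 2 + 1).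
Proof. by move=> t0; rewrite add0r enormZ gtr0_norm// exprMn; ring. Qed.

Let q1_gt0 z : 0 < enorm z ^+ 2 + 1.
Proof. by rewrite ltr_wpDl// exprn_ge0// enorm_ge0. Qed.

Let scale_poisson s t z : 0 < t ->
  (enorm (0 + t *: z) ^+ 2 + t ^+ 2) `^ (- a s) =
  t `^ (- (n%:R + 2 * s)) * (enorm z ^+ 2 + 1) `^ (- a s).
Proof.
move=> t0; rewrite scale_q// powRM ?(ltW (q1_gt0 z)) ?exprn_ge0 ?(ltW t0)//.
by rewrite sqr_powR ?(ltW t0)//; congr (_ `^ _ * _); rewrite /a; field.
Qed.

Let scale_ln t z : 0 < t ->
  2 * ln t - ln (enorm (0 + t *: z) ^+ 2 + t ^+ 2) = - ln (enorm z ^+ 2 + 1).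
Proof.
move=> t0; rewrite scale_q// lnM ?posrE ?exprn_gt0// lnXn// mulr_natl; ring.
Qed.

Lemma integrable_poisson s t : 0 < s -> 0 < t ->
  integrable_Rn (fun z => (enorm z ^+ 2 + t ^+ 2) `^ (- a s)).
Proof.
move=> s0 t0; apply/(@integrable_Rn_affine _ _ 0 t); first by rewrite gt_eqF.
  exact: measurable_bessel.
apply: eq_integrable_Rn (integrable_RnZ (t `^ (- (n%:R + 2 * s))) (integrable_poisson1 s0)) => z.
by rewrite scale_poisson.
Qed.

Let log_kernel s t z := (2 * ln t - ln (enorm z ^+ 2 + t ^+ 2)) * (enorm z ^+ 2 + t ^+ 2) `^ (- a s).

Lemma integrable_poisson_log s t : 0 < s -> 0 < t -> integrable_Rn (log_kernel s t).
Proof.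
move=> s0 t0; apply/(@integrable_Rn_affine _ _ 0 t); first by rewrite gt_eqF.
  apply: measurable_funM; last exact: measurable_bessel.
  by apply: measurable_funB => //; exact: measurable_ln_bessel.
apply: eq_integrable_Rn (integrable_RnZ (- t `^ (- (n%:R + 2 * s))) (integrable_poisson1_log s0)) => z.
by rewrite /log_kernel scale_poisson// scale_ln//; ring.
Qed.

Lemma p_ns_gt0 s : 0 < s -> 0 < p_ns n s.
Proof.
move=> s0; rewrite /p_ns invr_gt0 integral_RnE /Rintegral -lte_fin fineK; last first.
  exact: integrable_fin_num (integrable_poisson1 s0).
apply: integral_gt0 => //.
(* The whole space is not a null set because it contains the unit cube, of measure 1. *)
- apply/eqP => mu0.
  have := @lebesgue_Rn_box R n (fun=> `[0, 1]%classic) (fun=> measurable_itv _).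
  under eq_bigr do rewrite lebesgue_measure_itv/= lte_fin ltr01 sube0.
  rewrite big1// => mu1.
  have : (muN n [set x | forall i, `[0%R, 1%R]%classic (tnth x i)] <= muN n setT)%E.
    apply: le_measure; rewrite ?inE//.
    by apply: (@measurable_box R n (fun=> `[0%R, 1%R]%classic)) => i; exact: measurable_itv.
  by rewrite mu1 mu0 lee_fin ler10.
- by apply/measurable_EFinP; exact: measurable_bessel.
- by move=> y _; rewrite lte_fin powR_gt0.
Qed.

Lemma p_nsE s t : 0 < s -> 0 < t ->
  p_ns n s * (t `^ (2 * s) * integral_Rn setT (fun z : 'rV[R]_n => (enorm z ^+ 2 + t ^+ 2) `^ (- a s))) = 1.
Proof.
move=> s0 t0; have p0 := p_ns_gt0 s0.
rewrite (@integral_Rn_affine _ _ 0 t) ?(gt_eqF t0)//; last exact: integrable_poisson.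
rewrite (eq_integral_Rn (fun z => @scale_poisson s t z t0)).
rewrite integral_RnZ; last exact: integrable_poisson1.
rewrite gtr0_norm// -powR_mulrn ?(ltW t0)// !mulrA -(mulrA (p_ns n s)) -powRD ?(gt_eqF t0) ?implybT//.
rewrite -(mulrA (p_ns n s)) -powRD ?(gt_eqF t0) ?implybT//.
rewrite (_ : _ + _ + _ = 0); last by ring.
by rewrite powRr0 mulr1 mulVf// -invr_eq0 gt_eqF.
Qed.

(** After z = t zeta the factor 2 ln t - ln q becomes -ln(|zeta|^2 + 1), and t^(2s) t^n t^(-n-2s) =
    1. So the value does not depend on the height, which is why v_s has a boundary value
    proportional to u. *)
Lemma b_1E s t : 0 < s -> 0 < t ->
  p_ns n s * (t `^ (2 * s) * integral_Rn setT (log_kernel s t)) = b_1 n s.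
Proof.
move=> s0 t0; rewrite /b_1; congr (_ * _).
rewrite (@integral_Rn_affine _ _ 0 t) ?(gt_eqF t0)//; last exact: integrable_poisson_log.
have E z : log_kernel s t (0 + t *: z) = - t `^ (- (n%:R + 2 * s)) *
    (ln (enorm z ^+ 2 + 1) * (enorm z ^+ 2 + 1) `^ (- a s)).
  by rewrite /log_kernel scale_poisson// scale_ln//; ring.
rewrite (eq_integral_Rn E) integral_RnZ; last exact: integrable_poisson1_log.
rewrite gtr0_norm// -powR_mulrn ?(ltW t0)// mulNr !mulrN !mulrA -powRD ?(gt_eqF t0) ?implybT//.
rewrite -powRD ?(gt_eqF t0) ?implybT//.
rewrite (_ : _ + _ + _ = 0); last by ring.
rewrite powRr0 mul1r -mulN1r -integral_RnZ; last exact: integrable_poisson1_log.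
by apply: eq_integral_Rn => z; rewrite powRN mulN1r mulNr.
Qed.

End kernels.

(** * Symmetrized integrals *)

Section symmetrized.
Variables (R : realType) (n : nat) (u : 'rV[R]_n -> R).
Hypotheses (n0 : (0 < n)%N) (hu : smooth u) (hc : compactly_supported u).
Variable x : 'rV[R]_n.
Local Notation mR := (measurableTypeR R).
Local Notation muN := (lebesgue_Rn R).
Implicit Types (k : 'rV[R]_n -> R) (z : 'rV[R]_n) (s t e : R).

Definition second_difference z : R := 2 * u x - u (x + z) - u (x - z).
Local Notation D := second_difference.

Let nR : (0 : R) < n%:R. Proof. by rewrite ltr0n. Qed.

Lemma measurable_Rn_u : measurable_Rn u.
Proof. by apply: continuous_measurable_Rn; exact: smooth_continuous. Qed.

Let mshift c : measurable_Rn (fun z => u (x + c *: z)).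
Proof. by apply: measurable_Rn_affine; exact: measurable_Rn_u. Qed.

Lemma measurable_second_difference : measurable_Rn D.
Proof.
have m1 := mshift 1; have m2 := mshift (-1).
apply: measurable_funB; last by under eq_fun do rewrite -scaleN1r.
apply: measurable_funB => //.
by move: m1; rewrite /measurable_Rn; under eq_fun do rewrite scale1r.
Qed.

Lemma integrable_difference k : integrable_Rn k ->
  integrable_Rn (fun z => (u (x + z) - u x) * k z).
Proof.
move=> ki; have [M M0 HM] := compactly_supported_bounded hu hc.
apply: (le_integrable_Rn _ _ (integrable_RnZ (2 * M) ki)) => [|z].
  apply: measurable_funM; last exact: integrable_Rn_measurable.
  apply: measurable_funB => //.
  by have := mshift 1; rewrite /measurable_Rn; under eq_fun do rewrite scale1r.
rewrite !normrM ler_wpM2r// (ger0_norm M0) (ger0_norm (ler0n R 2)).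
by rewrite (le_trans (ler_normB _ _))// (_ : 2 * M = M + M) ?lerD//; ring.
Qed.

(** Averaging over z and -z requires the original integrand to be integrable. For the kernel
    |z|^(-n-2s) this can fail when s >= 1/2, so the lemma is applied to kernels cut off at the
    origin or regularized by t > 0, before any limit is taken. *)
Lemma integral_symmetrize k : (forall z, k (- z) = k z) ->
  integrable_Rn (fun z => (u (x + z) - u x) * k z) ->
  integral_Rn setT (fun z => (u (x + z) - u x) * k z) =
  - 2^-1 * integral_Rn setT (fun z => D z * k z).
Proof.
move=> kN; set f := (f in integrable_Rn f) => fi.
have fiN : integrable_Rn (fun z => f (- z)).
  have := (@integrable_Rn_affine _ _ 0 (-1) f _ (integrable_Rn_measurable fi)).2 fi.
  rewrite oppr_eq0 oner_eq0 => /(_ isT).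
  by apply: eq_integrable_Rn => z; rewrite add0r scaleN1r.
have -> : integral_Rn setT (fun z => D z * k z) = - 2 * integral_Rn setT f.
  rewrite (_ : - 2 * _ = -1 * (integral_Rn setT f + integral_Rn setT f)); last by ring.
  rewrite {2}(integral_Rn_opp fi) -integral_RnD// -integral_RnZ; last exact: integrable_RnD.
  by apply: eq_integral_Rn => z; rewrite /f kN /D; ring.
by field.
Qed.

Lemma integrable_second_difference (s C : R) k : 0 < s < 1 -> measurable_Rn k ->
  (forall z, `|k z| <= C * enorm z `^ (- (n%:R + 2 * s))) ->
  integrable_Rn (fun z => D z * k z).
Proof.
move=> s01 mk kle; have [K K0 HK] := second_difference_bound hu hc x.
apply: (@integrable_riesz _ _ n0 (K * `|C|) s) => // [|z].
  by apply: measurable_funM => //; exact: measurable_second_difference.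
have m0 : 0 <= Num.min 1 (enorm z ^+ 2) by rewrite le_min ler01 exprn_ge0 ?enorm_ge0.
rewrite normrM -[X in _ <= X]mulrA mulrACA ler_pM ?HK//.
rewrite (le_trans (kle z))// ler_wpM2r ?powR_ge0//; exact: ler_norm.
Qed.

(** The sum on the right avoids distinguishing r <= 1 from r > 1 later on. At r = 0 all three powers
    are 0 by convention, since the exponents are nonzero. *)
Let powR_between (r p p1 p2 : R) : 0 <= r -> 0 < p1 -> p1 <= p <= p2 ->
  r `^ (- p) <= r `^ (- p1) + r `^ (- p2).
Proof.
rewrite le_eqVlt => /orP[/eqP <- p10 /andP[p1p pp2]|r0 p10 /andP[p1p pp2]].
  rewrite !powR0 ?oppr_eq0 ?gt_eqF ?addr0//; lra.
have [r1|r1] := leP r 1.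
  by rewrite (le_trans (ler_powRN _ pp2)) ?r0// lerDr powR_ge0.
by rewrite (le_trans (ler_powR (ltW r1) (_ : - p <= - p1))) ?lerN2// lerDl powR_ge0.
Qed.

(** The common majorant of all integrands D(z) k(z): the smaller order s1 controls infinity and the
    larger order s2 controls the origin. *)
Let dominator (C s1 s2 : R) z := `|D z| * (C * (enorm z `^ (- (n%:R + 2 * s1)) + enorm z `^ (- (n%:R + 2 * s2)))).

Let dominator_ge0 C s1 s2 z : 0 <= C -> 0 <= dominator C s1 s2 z.
Proof. by move=> C0; rewrite !mulr_ge0 ?addr_ge0 ?powR_ge0. Qed.

Let measurable_enormp p : measurable_Rn (fun z : 'rV[R]_n => enorm z `^ p).
Proof. exact: (measurableT_comp (@measurable_powR R p) (@measurable_enorm R n)). Qed.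

Let integrable_dominator C s1 s2 : 0 < s1 < 1 -> 0 < s2 < 1 ->
  integrable_Rn (dominator C s1 s2).
Proof.
move=> s1P s2P.
have I1 := @integrable_second_difference s1 1 (fun z => enorm z `^ (- (n%:R + 2 * s1))) s1P
  (measurable_enormp _) _.
have I2 := @integrable_second_difference s2 1 (fun z => enorm z `^ (- (n%:R + 2 * s2))) s2P
  (measurable_enormp _) _.
have b p z : `|enorm z `^ p| <= 1 * enorm z `^ p by rewrite mul1r ger0_norm// powR_ge0.
have I := integrable_RnZ C (integrable_RnD (I1 (fun z => b _ z)) (I2 (fun z => b _ z))).
apply: le_integrable_Rn I => [|z]; last by rewrite -mulrDr !normrM normr_id mulrCA.
apply: measurable_funM; last first.
  by apply: measurable_funM => //; apply: measurable_funD; exact: measurable_enormp.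
exact: (measurableT_comp (@normr_measurable R setT) measurable_second_difference).
Qed.

(** The kernels have default values at the origin, where neither their bounds nor their continuity
    in the parameter can be relied on. The vanishing of D there lets all pointwise arguments assume
    z != 0. *)
Lemma second_difference0 : D 0 = 0.
Proof. by rewrite /D addr0 subr0; ring. Qed.

Let eqD0 z : enorm z = 0 -> D z = 0.
Proof. by move=> /enorm_eq0 ->; exact: second_difference0. Qed.

Definition riesz s z : R := enorm z `^ (- (n%:R + 2 * s)).

Definition riesz_integral s : R := integral_Rn setT (fun z => D z * riesz s z).

Lemma integrable_second_difference_riesz s : 0 < s < 1 -> integrable_Rn (fun z => D z * riesz s z).
Proof.
move=> s01; apply: (@integrable_second_difference s 1) => // [|z]; first exact: measurable_enormp.
by rewrite mul1r ger0_norm// powR_ge0.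
Qed.

Let truncated s e z : R := if e < enorm z then riesz s z else 0.

Let measurable_truncated s e : measurable_Rn (truncated s e).
Proof.
apply: measurable_fun_ifT => //; last exact: measurable_enormp.
by apply: measurable_fun_ltr; [exact: measurable_cst|exact: measurable_enorm].
Qed.

Let integrable_truncated s e : 0 < s < 1 -> 0 < e -> integrable_Rn (truncated s e).
Proof.
move=> s01 e0; have m0 : 0 < Num.min 1 (e ^+ 2) by rewrite lt_min ltr01 exprn_gt0.
(* Where |z| > e, min(1, e^2) <= min(1, |z|^2), so this constant makes up for the missing factor. *)
apply: (@integrable_riesz _ _ n0 (Num.min 1 (e ^+ 2))^-1 s) => // z.
have mz : 0 <= Num.min 1 (enorm z ^+ 2) by rewrite le_min ler01 exprn_ge0 ?enorm_ge0.
rewrite /truncated; case: ifPn => [ez|_]; last first.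
  by rewrite normr0 !mulr_ge0 ?powR_ge0// invr_ge0 ltW.
rewrite ger0_norm ?powR_ge0// /riesz ler_peMl ?powR_ge0//.
rewrite mulrC ler_pdivlMr// mul1r le_min !ge_min lexx/=.
by rewrite ler_pXn2r ?nnegrE ?enorm_ge0 ?(ltW e0)// (ltW ez) orbT.
Qed.

Let truncatedN s e z : truncated s e (- z) = truncated s e z.
Proof. by rewrite /truncated /riesz enormN. Qed.

Lemma truncated_integralE s e : 0 < s < 1 -> 0 < e ->
  truncated_integral s u x e =
  2^-1 * integral_Rn setT (fun z => D z * truncated s e z).
Proof.
move=> s01 e0.
have fi := integrable_difference (integrable_truncated s01 e0).
pose g y := (u x - u y) * truncated s e (x + -1 *: y).
have gE z : g (x + z) = -1 * ((u (x + z) - u x) * truncated s e z).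
  by rewrite /g scaleN1r opprD addNKr truncatedN; ring.
have mg : measurable_Rn g.
  apply: measurable_funM.
    by apply: measurable_funB => //; exact: measurable_Rn_u.
  by apply: measurable_Rn_affine; exact: measurable_truncated.
have gi : integrable_Rn g.
  apply: (@integrable_Rn_affine _ _ x 1 g _ mg).1; first by rewrite oner_eq0.
  by apply: eq_integrable_Rn (integrable_RnZ (-1) fi) => z; rewrite scale1r gE.
rewrite /truncated_integral integral_Rn_mkcond.
rewrite (@eq_integral_Rn _ _ _ g); last first.
  move=> y; rewrite patchE /g /truncated scaleN1r; case: ifPn.
    by rewrite inE/= => ->; rewrite /riesz powRN.
  by rewrite notin_setE/= => /negP/negbTE ->; rewrite mulr0.
rewrite (integral_Rn_shift x gi) (eq_integral_Rn gE) integral_RnZ//.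
rewrite (integral_symmetrize (truncatedN s e) fi).
by ring.
Qed.

(** Once symmetrized, the truncated integrands are dominated by |D(z)| |z|^(-n-2s), and at each z !=
    0 they are eventually constant as the cutoff shrinks. Passing to sequences of cutoffs makes
    dominated convergence applicable, and the principal value becomes an absolutely convergent
    integral. *)
Lemma cvg_truncated_integral s : 0 < s < 1 ->
  truncated_integral s u x e @[e --> 0^'+] --> 2^-1 * riesz_integral s.
Proof.
move=> s01; apply/cvg_at_rightP => w [w0 wcvg].
under eq_fun => k do rewrite truncated_integralE//.
apply: cvgMl_tmp.
have mD := measurable_second_difference.
have iD := integrable_second_difference_riesz s01.
pose f (k : nat) (y : n.-tuple mR) := (D (Defs.point y) * truncated s (w k) (Defs.point y))%:E.
rewrite /riesz_integral integral_RnE.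
under eq_fun do rewrite integral_RnE.
apply: fine_cvg; rewrite fineK; last exact: integrable_fin_num iD.
apply: (@dominated_cvg _ _ _ (muN n) setT measurableT f _
  (fun y => `|D (Defs.point y) * riesz s (Defs.point y)|%:E)).
- move=> k; apply/measurable_EFinP; apply: measurable_funM => //.
  exact: measurable_truncated.
- move=> y _; apply: cvg_EFin; first exact: nearW.
  rewrite /f/=; set z := Defs.point y.
  have [z0|zne] := eqVneq (enorm z) 0.
    rewrite (eqD0 z0) mul0r; under eq_fun do rewrite mul0r.
    exact: cvg_cst.
  apply: cvgMl_tmp; apply: cvg_near_cst; near=> k.
  rewrite /truncated ifT//; near: k.
  by apply: (cvgr_lt 0 wcvg); rewrite lt_neqAle eq_sym zne enorm_ge0.
- by [].
- exact: (integrable_norm iD).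
- move=> k y _; rewrite lee_fin !normrM ler_wpM2l//.
  by rewrite /truncated; case: ifPn => // _; rewrite normr0.
Unshelve. all: by end_near. Qed.

Let ln_powR_le (r e p p1 p2 : R) : 0 < r -> 0 < e -> 0 < p1 -> p1 <= p - e -> p + e <= p2 ->
  `|ln r| * r `^ (- p) <= 2 / e * (r `^ (- p1) + r `^ (- p2)).
Proof.
move=> r0 e0 p10 p1p pp2.
have h q : p1 <= q <= p2 -> r `^ (- q) <= r `^ (- p1) + r `^ (- p2).
  by move=> ?; apply: powR_between => //; exact: ltW.
rewrite (le_trans (ler_wpM2r (powR_ge0 _ _) (normr_ln_le e0 r0)))//.
have E q : r `^ q * r `^ (- p) = r `^ (q - p) by rewrite powRD// (gt_eqF r0) implybT.
have H1 : r `^ (- e - p) <= r `^ (- p1) + r `^ (- p2).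
  by rewrite (_ : - e - p = - (p + e)); [apply: h; apply/andP; split; lra|ring].
have H2 : r `^ (e - p) <= r `^ (- p1) + r `^ (- p2).
  by rewrite (_ : e - p = - (p - e)); [apply: h; apply/andP; split; lra|ring].
rewrite (mulrC 2) -!(mulrA e^-1) mulrDl !E.
by rewrite ler_wpM2l ?invr_ge0 ?(ltW e0)//; lra.
Qed.

Let dominatorE C s1 s2 z (k : R) : (enorm z != 0 ->
    `|k| <= C * (enorm z `^ (- (n%:R + 2 * s1)) + enorm z `^ (- (n%:R + 2 * s2)))) ->
  `|D z * k| <= dominator C s1 s2 z.
Proof.
rewrite /dominator normrM; have [z0 _|zne] := eqVneq (enorm z) 0.
  by rewrite eqD0// normr0 !mul0r.
by move=> /(_ isT) H; rewrite ler_wpM2l.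
Qed.

Let measurable_log_riesz s : measurable_Rn (fun z => D z * (ln (enorm z) * riesz s z)).
Proof.
apply: measurable_funM; first exact: measurable_second_difference.
apply: measurable_funM; last exact: measurable_enormp.
exact: (measurableT_comp (@measurable_ln R) (@measurable_enorm R n)).
Qed.

Lemma integrable_second_difference_log_riesz s : 0 < s < 1 ->
  integrable_Rn (fun z => D z * (ln (enorm z) * riesz s z)).
Proof.
move=> /andP[s0 s1].
(* The exponents n + 2s - e and n + 2s + e belong to the orders s - e/2 and s + e/2, both inside
   (0,1). *)
pose e := Num.min s (1 - s).
have e0 : 0 < e by rewrite lt_min s0 subr_gt0.
have es : e <= s by rewrite ge_min lexx.
have es' : e <= 1 - s by rewrite ge_min lexx orbT.
have iG : integrable_Rn (dominator (2 / e) (s - e / 2) (s + e / 2)).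
  by apply: integrable_dominator; apply/andP; split; lra.
apply: (le_integrable_Rn (measurable_log_riesz s) _ iG) => z.
rewrite [leRHS]ger0_norm; last by rewrite dominator_ge0// divr_ge0// ltW.
apply: dominatorE => zne.
have r0 : 0 < enorm z by rewrite lt_neqAle eq_sym zne enorm_ge0.
rewrite normrM (ger0_norm (powR_ge0 _ _)).
by have n0R := nR; apply: (ln_powR_le r0 e0); lra.
Qed.

Lemma is_derive_riesz_integral s : 0 < s < 1 ->
  is_derive s 1 riesz_integral
    (- 2 * integral_Rn setT (fun z => D z * (ln (enorm z) * riesz s z))).
Proof.
move=> /andP[s0 s1].
have Dr (t : R) z : is_derive t 1 (fun t => D z * riesz t z) (D z * (- 2 * (ln (enorm z) * riesz t z))).
  have [z0|zne] := eqVneq (enorm z) 0.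
    by rewrite eqD0// mul0r; under eq_fun do rewrite mul0r; exact: is_derive_cst.
  have r0 : 0 < enorm z by rewrite lt_neqAle eq_sym zne enorm_ge0.
  have D1 := is_derive_powRr (- (n%:R + 2 * t)) r0.
  have D2 : is_derive t 1 (fun p : R => - (n%:R + 2 * p)) (- 2).
    by apply: is_derive_eq; rewrite /GRing.scale/=; ring.
  have D3 := @is_derive1_comp _ (fun p => enorm z `^ p) (fun p => - (n%:R + 2 * p)) t _ _ D1 D2.
  apply: is_derive_eq.
  by rewrite /GRing.scale/= /riesz; ring.
(* The order t runs over ]s/2, (1+s)/2[. A shift by [e] in either direction keeps it between s/4 and
   (3+s)/4, the two orders of the dominator. In the exponent n + 2t this shift counts twice, so the
   logarithm is estimated with 2e. *)
pose e := Num.min s (1 - s) / 4.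
have e0 : 0 < e by rewrite divr_gt0// lt_min s0 subr_gt0.
have es : e <= s / 4 by rewrite ler_pM2r ?invr_gt0// ge_min lexx.
have es' : e <= (1 - s) / 4 by rewrite ler_pM2r ?invr_gt0// ge_min lexx orbT.
pose F (t : R) (y : n.-tuple mR) := D (Defs.point y) * riesz t (Defs.point y).
have d1E t y : partial1of2 F t y = - 2 * (D (Defs.point y) * (ln (enorm (Defs.point y)) * riesz t (Defs.point y))).
  by rewrite partial1of2E; have [_ ->] := Dr t (Defs.point y); ring.
have Is : `](s / 2), ((1 + s) / 2)[%classic s by rewrite /= in_itv/=; apply/andP; split; lra.
have iF t : `](s / 2), ((1 + s) / 2)[%classic t -> (muN n).-integrable setT (EFin \o F t).
  rewrite /= in_itv/= => /andP[t1 t2].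
  by apply: integrable_second_difference_riesz; apply/andP; split; lra.
have dF t y : `](s / 2), ((1 + s) / 2)[%classic t -> [set: n.-tuple mR] y -> derivable (F ^~ y) t 1.
  by move=> _ _; have [] := Dr t (Defs.point y).
pose G (y : n.-tuple mR) := dominator (2 / e) (s / 4) ((3 + s) / 4) (Defs.point y).
have G0 y : 0 <= G y by rewrite dominator_ge0// divr_ge0// ltW.
have iG : (muN n).-integrable setT (EFin \o G).
  by apply: integrable_dominator; apply/andP; split; lra.
have GF t y : `](s / 2), ((1 + s) / 2)[%classic t -> [set: n.-tuple mR] y -> `|partial1of2 F t y| <= G y.
  rewrite /= in_itv/= => /andP[t1 t2] _; rewrite d1E mulrCA.
  apply: dominatorE => zne.
  have r0 : 0 < enorm (Defs.point y) by rewrite lt_neqAle eq_sym zne enorm_ge0.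
  have e20 : 0 < 2 * e by lra.
  have n0R := nR.
  have q1 : 0 < n%:R + 2 * (s / 4) by lra.
  have q2 : n%:R + 2 * (s / 4) <= n%:R + 2 * t - 2 * e by lra.
  have q3 : n%:R + 2 * t + 2 * e <= n%:R + 2 * ((3 + s) / 4) by lra.
  have := ln_powR_le r0 e20 q1 q2 q3.
  rewrite !normrM normrN (ger0_norm (ler0n R 2)) (ger0_norm (powR_ge0 _ _)) => H.
  move: H; set S := (X in _ <= _ * X -> _) => H.
  rewrite (_ : 2 / e * S = 2 * (2 / (2 * e) * S)); last by field; lra.
  by rewrite ler_wpM2l.
have E : riesz_integral = (fun t => \int[muN n]_y F t y).
  by apply/funext => t; rewrite /riesz_integral integral_RnE.
split.
  rewrite E; exact: (@derivable_under_integral _ _ _ (muN n) F setT measurableT s _ _ Is iF dF G G0 iG GF).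
rewrite E -derive1E (@differentiation_under_integral _ _ _ (muN n) F setT measurableT s _ _ Is iF dF G G0 iG GF).
rewrite integral_RnE -RintegralZl//.
  by apply: eq_Rintegral => y _; rewrite -[LHS]/(partial1of2 F s y) d1E.
apply: integrable_second_difference_log_riesz; exact/andP.
Qed.

(** The one-sided limit comes from continuity at the interior point 0 of ]-1, 1[. The kernels to
    which this is applied depend on t only through t^2, so negative t are covered by the same
    bounds. *)
Lemma cvg_integral_second_difference (K : R -> 'rV[R]_n -> R) (C s1 s2 : R) :
  0 <= C -> 0 < s1 < 1 -> 0 < s2 < 1 ->
  (forall t, measurable_Rn (K t)) ->
  (forall t z, -1 < t < 1 -> enorm z != 0 ->
    `|K t z| <= C * (enorm z `^ (- (n%:R + 2 * s1)) + enorm z `^ (- (n%:R + 2 * s2)))) ->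
  (forall z, enorm z != 0 -> continuous (K ^~ z)) ->
  integral_Rn setT (fun z => D z * K t z) @[t --> 0^'+] -->
    integral_Rn setT (fun z => D z * K 0 z).
Proof.
move=> C0 s1P s2P mK bK cK.
pose F (t : R) (y : n.-tuple mR) := D (Defs.point y) * K t (Defs.point y).
pose G (y : n.-tuple mR) := dominator C s1 s2 (Defs.point y).
have iG : (muN n).-integrable setT (EFin \o G) by exact: integrable_dominator.
have FG t y : -1 < t < 1 -> `|F t y| <= G y.
  by move=> t1; apply: dominatorE => zne; exact: bK.
have iF t : `]-1, 1[%classic t -> (muN n).-integrable setT (EFin \o F t).
  rewrite /= in_itv/= => t1.
  apply: (@le_integrable _ _ _ (muN n) setT measurableT _ _ _ _ iG).
    by apply/measurable_EFinP; apply: measurable_funM; [exact: measurable_second_difference|exact: mK].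
  by move=> y _; rewrite lee_fin (le_trans (FG _ _ t1))// ler_norm.
have cF : {ae muN n, forall y, [set: n.-tuple mR] y -> {in `]-1, 1[%classic, continuous (F ^~ y)}}.
  apply: aeW => y _ t _; rewrite /F; set z := Defs.point y.
  have [z0|zne] := eqVneq (enorm z) 0.
    by rewrite eqD0//; under eq_fun do rewrite mul0r; exact: cvg_cst.
  by apply: cvgMl_tmp; exact: cK.
have aeFG t : `]-1, 1[%classic t -> {ae muN n, forall y, [set: n.-tuple mR] y -> `|F t y| <= G y}.
  by rewrite /= in_itv/= => t1; apply: aeW => y _; exact: FG.
have := @continuity_under_integral _ _ _ (muN n) F setT measurableT (-1) 1 iF cF G iG aeFG 0.
rewrite inE/= in_itv/= ltrN10 ltr01 => /(_ isT) c0.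
rewrite integral_RnE; under eq_fun do rewrite integral_RnE.
by apply: cvg_at_right_filter; exact: c0.
Qed.

End symmetrized.

(** * Limits at the boundary *)

Section c_ns_regularity.
Variables (R : realType) (n : nat).
Hypothesis n0 : (0 < n)%N.

Lemma c_ns_gt0 (s : R) : 0 < s < 1 -> 0 < c_ns n s.
Proof.
move=> /andP[s0 s1]; have nR : (0 : R) < n%:R by rewrite ltr0n.
have G1 : 0 < Gamma ((n%:R + 2 * s) / 2) by apply: Gamma_gt0; lra.
have G2 : 0 < Gamma (1 - s) by apply: Gamma_gt0; lra.
by apply: mulr_gt0; [rewrite !mulr_gt0 ?powR_gt0 ?pi_gt0|exact: divr_gt0].
Qed.

Lemma derivable_c_ns (s : R) : 0 < s < 1 -> derivable (@c_ns R n) s 1.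
Proof.
move=> /andP[s0 s1]; have nR : (0 : R) < n%:R by rewrite ltr0n.
have comp (f : R -> R) (c d : R) : derivable f (c * s + d) 1 -> derivable (fun t => f (c * t + d)) s 1.
  move=> df; have D : is_derive s 1 (fun t : R => c * t + d) c.
    by apply: is_derive_eq; rewrite /GRing.scale/=; ring.
  by have [] := @is_derive1_comp _ f (fun t => c * t + d) s _ _ (derivableP df) D.
have D1 : derivable (fun t : R => 2 `^ (2 * t)) s 1.
  under eq_fun do rewrite -[2 * _]addr0.
  by apply: (comp (fun t => 2 `^ t)); have [] := is_derive_powRr (2 * s + 0) (ltr0n R 2).
have D2 : derivable (fun t : R => Gamma ((n%:R + 2 * t) / 2)) s 1.
  have E t : (n%:R + 2 * t) / 2 = 1 * t + n%:R / 2 :> R by field.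
  under eq_fun do rewrite E.
  by apply: comp; apply: derivable_Gamma; lra.
have D3 : derivable (fun t : R => Gamma (1 - t)) s 1.
  have E t : 1 - t = -1 * t + 1 :> R by ring.
  under eq_fun do rewrite E.
  by apply: comp; apply: derivable_Gamma; lra.
have G0 : Gamma (1 - s) != 0 by rewrite gt_eqF// Gamma_gt0//; lra.
(* Naming the factors presents [c_ns] as a product of functions, the form to which the product rule
   [derivableM] applies. *)
pose f1 (t : R) : R := 2 `^ (2 * t).
pose f2 (t : R) : R := pi `^ (- (n%:R / 2)).
pose f3 (t : R) : R := t.
pose f4 (t : R) : R := Gamma ((n%:R + 2 * t) / 2).
pose f5 (t : R) : R := Gamma (1 - t).
have D5 : derivable (fun t => (f5 t)^-1) s 1 by exact: (@derivableV _ _ f5 s 1 G0 D3).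
have D2c : derivable f2 s 1 by exact: derivable_cst.
have D3i : derivable f3 s 1 by exact: derivable_id.
have -> : @c_ns R n = f1 * f2 * f3 * (f4 * (fun t => (f5 t)^-1)) by apply/funext.
exact: (derivableM (derivableM (derivableM D1 D2c) D3i) (derivableM D2 D5)).
Qed.

Lemma b_nsE (s : R) : 0 < s < 1 -> b_ns n s * c_ns n s = 'D_1 (@c_ns R n) s.
Proof.
move=> s01; have c0 := c_ns_gt0 s01.
rewrite /b_ns derive1E.
have [_ ->] := @is_derive1_comp _ (@ln R) (@c_ns R n) s _ _ (is_derive1_ln c0) (derivableP (derivable_c_ns s01)).
by rewrite /GRing.scale/= mulrAC mulVf ?mul1r ?gt_eqF.
Qed.

End c_ns_regularity.

(** * Boundary behaviour of w_s and v_s, and the derivative in the order *)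

Section extension_limits.
Variables (R : realType) (n : nat) (u : 'rV[R]_n -> R).
Hypotheses (n0 : (0 < n)%N) (hu : smooth u) (hc : compactly_supported u).
Variables (x : 'rV[R]_n) (s : R).
Hypothesis s01 : 0 < s < 1.
Implicit Types (k : 'rV[R]_n -> R) (z : 'rV[R]_n) (t : R).
Local Notation D := (second_difference u x).
Local Notation a := ((n%:R + 2 * s) / 2).

Let s_gt0 : 0 < s. Proof. by case/andP: s01. Qed.

Lemma integrable_second_differenceM k : integrable_Rn k -> integrable_Rn (fun z => D z * k z).
Proof.
move=> ki; have [K K0 HK] := second_difference_bound hu hc x.
apply: (le_integrable_Rn _ _ (integrable_RnZ K ki)) => [|z].
  apply: measurable_funM; last exact: integrable_Rn_measurable.
  exact: measurable_second_difference.
rewrite !normrM (ger0_norm K0) ler_wpM2r// (le_trans (HK z))//.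
by rewrite ler_piMr// ge_min lexx.
Qed.

(** In y = x + z, u(x + z) is split as u(x) plus a difference. The first part yields the total mass
    of the kernel, that is the boundary value; the second is symmetrized. The constant c absorbs the
    factor t^(2s) that stands inside the integral of w_s. *)
Lemma integral_convolution_symmetrize (c : R) k f :
  (forall z, k (- z) = k z) -> integrable_Rn k ->
  (forall y, f y = c * (u y * k (x - y))) ->
  integral_Rn setT f =
  c * (u x * integral_Rn setT k - 2^-1 * integral_Rn setT (fun z => D z * k z)).
Proof.
move=> kN ki fE.
have mf : measurable_Rn f.
  have -> : f = (fun y => c * (u y * k (x + -1 *: y))).
    by apply/funext => y; rewrite scaleN1r.
  apply: measurable_funM => //; apply: measurable_funM; first exact: measurable_Rn_u.
  by apply: measurable_Rn_affine; exact: integrable_Rn_measurable.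
have di := integrable_difference hu hc x ki.
have E z : f (x + z) = c * ((u (x + z) - u x) * k z + u x * k z).
  by rewrite fE opprD addNKr kN; ring.
have ci := integrable_RnD di (integrable_RnZ (u x) ki).
have fi : integrable_Rn f.
  apply: (@integrable_Rn_affine _ _ x 1 f _ mf).1; first by rewrite oner_eq0.
  by apply: eq_integrable_Rn (integrable_RnZ c ci) => z; rewrite scale1r E.
rewrite (integral_Rn_shift x fi) (eq_integral_Rn E) integral_RnZ//.
rewrite integral_RnD//; last exact: integrable_RnZ.
by rewrite integral_symmetrize// integral_RnZ//; ring.
Qed.

Let kernel t z := (enorm z ^+ 2 + t ^+ 2) `^ (- a).
Let log_kernel t z := (2 * ln t - ln (enorm z ^+ 2 + t ^+ 2)) * kernel t z.

Definition poisson_part t := integral_Rn setT (fun z => D z * kernel t z).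
Definition log_part t :=
  integral_Rn setT (fun z => D z * (ln (enorm z ^+ 2 + t ^+ 2) * kernel t z)).

Let kernelN t z : kernel t (- z) = kernel t z.
Proof. by rewrite /kernel enormN. Qed.

Let log_kernelN t z : log_kernel t (- z) = log_kernel t z.
Proof. by rewrite /log_kernel kernelN enormN. Qed.

Lemma w_s_sub_boundary t : 0 < t ->
  w_s s u (x, t) - u x = - (p_ns n s / 2) * t `^ (2 * s) * poisson_part t.
Proof.
move=> t0; rewrite /w_s/=.
rewrite (@integral_convolution_symmetrize (t `^ (2 * s)) (kernel t)).
- have P : p_ns n s * (t `^ (2 * s) * integral_Rn setT (kernel t)) = 1 by exact: p_nsE.
  rewrite -/(poisson_part t) (_ : p_ns n s * _ = p_ns n s * (t `^ (2 * s) * integral_Rn setT (kernel t)) * u x -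
    p_ns n s / 2 * t `^ (2 * s) * poisson_part t); last by field.
  by rewrite P; ring.
- exact: kernelN.
- exact: integrable_poisson.
- by move=> y; rewrite /kernel powRN; ring.
Qed.

Lemma v_s_sub_boundary t : 0 < t ->
  v_s s u (x, t) - b_1 n s * u x =
  - (p_ns n s / 2) * t `^ (2 * s) * (2 * ln t * poisson_part t - log_part t).
Proof.
move=> t0; rewrite /v_s/=.
have ik : integrable_Rn (kernel t) by exact: integrable_poisson.
have il : integrable_Rn (log_kernel t) by exact: integrable_poisson_log.
have iDk := integrable_second_differenceM ik.
have iDl := integrable_second_differenceM il.
rewrite (@integral_convolution_symmetrize 1 (log_kernel t) _ (log_kernelN t) il).
- have -> : log_part t = 2 * ln t * poisson_part t - integral_Rn setT (fun z => D z * log_kernel t z).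
    rewrite /poisson_part -integral_RnZ// -integral_RnB//; last exact: integrable_RnZ.
    by apply: eq_integral_Rn => z; rewrite /log_kernel; ring.
  have P : p_ns n s * (t `^ (2 * s) * integral_Rn setT (log_kernel t)) = b_1 n s by exact: b_1E.
  by rewrite -P; field.
- by move=> y; rewrite /log_kernel /kernel powRN; ring.
Qed.

Let J := integral_Rn setT (fun z => D z * (ln (enorm z) * riesz s z)).

(** Dropping t^2 increases a nonpositive power, which gives a bound uniform in t. The shift [e] may
    have either sign: zero serves the Poisson kernel, and both signs serve the logarithmic one. *)
Let kernel_le (t e : R) z : enorm z != 0 -> e <= a ->
  (enorm z ^+ 2 + t ^+ 2) `^ (- (a - e)) <= enorm z `^ (- (n%:R + 2 * (s - e))).
Proof.
move=> zne ea; have r0 : 0 < enorm z by rewrite lt_neqAle eq_sym zne enorm_ge0.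
rewrite (_ : - (n%:R + 2 * (s - e)) = 2 * - (a - e)); last by field.
have r20 : 0 < enorm z ^+ 2 by rewrite exprn_gt0.
have t20 : 0 <= t ^+ 2 by exact: sqr_ge0.
have q0 : 0 < enorm z ^+ 2 + t ^+ 2 by lra.
rewrite -sqr_powR ?(ltW r0)// !powRN lef_pV2 ?posrE ?powR_gt0//.
by rewrite ge0_ler_powR ?nnegrE ?subr_ge0//; lra.
Qed.

Let a_gt0 : 0 < a. Proof. by have := s_gt0; have := ltr0n R n; rewrite n0; lra. Qed.

Let continuous_q z : continuous (fun t : R => enorm z ^+ 2 + t ^+ 2).
Proof.
by move=> t; apply: cvgD; [exact: cvg_cst|exact: exprn_continuous].
Qed.

Let continuous_kernel z : enorm z != 0 -> continuous (kernel ^~ z).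
Proof.
move=> zne t.
have r0 : 0 < enorm z by rewrite lt_neqAle eq_sym zne enorm_ge0.
have q0 : 0 < enorm z ^+ 2 + t ^+ 2 by rewrite ltr_wpDr ?sqr_ge0// exprn_gt0.
apply: (@continuous_comp _ _ _ (fun t : R => enorm z ^+ 2 + t ^+ 2) (fun q => q `^ (- a))).
  exact: continuous_q.
apply: differentiable_continuous; apply/derivable1_diffP.
by have := is_derive1_powR (- a) q0 => -[].
Qed.

Let kernel0 z : kernel 0 z = riesz s z.
Proof.
rewrite /kernel expr0n addr0 sqr_powR; last exact: enorm_ge0.
by rewrite /riesz; congr (_ `^ _); field.
Qed.

Lemma cvg_poisson_part : poisson_part t @[t --> 0^'+] --> riesz_integral u x s.
Proof.
have -> : riesz_integral u x s = integral_Rn setT (fun z => D z * kernel 0 z).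
  by apply: eq_integral_Rn => z; rewrite kernel0.
apply: (@cvg_integral_second_difference _ _ _ n0 hu hc x kernel 1 s s) => // [t|t z _ zne].
  exact: measurable_bessel.
have := kernel_le t zne (ltW a_gt0); rewrite !subr0 => H.
rewrite mul1r ger0_norm ?powR_ge0// (le_trans H)// lerDl powR_ge0//.
Qed.

Lemma cvg_log_part : log_part t @[t --> 0^'+] --> 2 * J.
Proof.
pose K t z := ln (enorm z ^+ 2 + t ^+ 2) * kernel t z.
have [s0 s1] := andP s01.
have iJ : integrable_Rn (fun z => D z * (ln (enorm z) * riesz s z)).
  exact: integrable_second_difference_log_riesz.
have -> : 2 * J = integral_Rn setT (fun z => D z * K 0 z).
  rewrite -integral_RnZ//; apply: eq_integral_Rn => z; rewrite /K kernel0 expr0n addr0.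
  (* At the origin both logarithms are 0 by convention; elsewhere ln(|z|^2) = 2 ln|z| produces the
     factor 2. *)
  have [z0|zne] := eqVneq (enorm z) 0; first by rewrite z0 expr0n /= !ln0//; ring.
  by rewrite lnXn; [rewrite -mulr_natl; ring|rewrite lt_neqAle eq_sym zne enorm_ge0].
(* The logarithm of q = |z|^2 + t^2 costs q^e or q^(-e), a shift of the order by [e]; halving keeps
   s - e and s + e inside (0,1). *)
pose e := Num.min s (1 - s) / 2.
have e0 : 0 < e by rewrite divr_gt0// lt_min s0 subr_gt0.
have es : e <= s / 2 by rewrite ler_pM2r ?invr_gt0// ge_min lexx.
have es' : e <= (1 - s) / 2 by rewrite ler_pM2r ?invr_gt0// ge_min lexx orbT.
have nR : (0 : R) < n%:R by rewrite ltr0n.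
apply: (@cvg_integral_second_difference _ _ _ n0 hu hc x K e^-1 (s - e) (s + e)).
- by rewrite invr_ge0 ltW.
- by apply/andP; split; lra.
- by apply/andP; split; lra.
- by move=> t; apply: measurable_funM; [exact: measurable_ln_bessel|exact: measurable_bessel].
- move=> t z _ zne.
  have r0 : 0 < enorm z by rewrite lt_neqAle eq_sym zne enorm_ge0.
  have q0 : 0 < enorm z ^+ 2 + t ^+ 2 by rewrite ltr_wpDr ?sqr_ge0// exprn_gt0.
  have ea : e <= a by lra.
  have ea' : - e <= a by lra.
  have H1 := kernel_le t zne ea; have H2 := kernel_le t zne ea'; rewrite opprK in H2.
  rewrite normrM [X in _ * X]ger0_norm ?powR_ge0//.
  rewrite (le_trans (ler_wpM2r (powR_ge0 _ _) (normr_ln_le e0 q0)))//.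
  have E p : (enorm z ^+ 2 + t ^+ 2) `^ p * kernel t z = (enorm z ^+ 2 + t ^+ 2) `^ (p - a).
    by rewrite /kernel -powRD// (gt_eqF q0) implybT.
  rewrite -(mulrA e^-1) mulrDl !E ler_wpM2l ?invr_ge0 ?(ltW e0)// lerD//.
    by rewrite (_ : e - a = - (a - e)); [exact: H1|ring].
  by rewrite (_ : - e - a = - (a - - e)); [rewrite opprK; exact: H2|ring].
- move=> z zne t; apply: cvgM; last exact: continuous_kernel.
  have r0 : 0 < enorm z by rewrite lt_neqAle eq_sym zne enorm_ge0.
  have q0 : 0 < enorm z ^+ 2 + t ^+ 2 by rewrite ltr_wpDr ?sqr_ge0// exprn_gt0.
  apply: (@continuous_comp _ _ _ (fun t : R => enorm z ^+ 2 + t ^+ 2) (@ln R)).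
    exact: continuous_q.
  exact: continuous_ln.
Qed.

(** Absorbing ln t with e = s leaves a multiple of t^(3s) + t^s, both exponents being positive. *)
Let cvg_powR_ln : t `^ (2 * s) * (2 * ln t) @[t --> 0^'+] --> (0 : R).
Proof.
have s0 := s_gt0.
have B (t : R) : 0 < t -> `|t `^ (2 * s) * (2 * ln t)| <= 2 / s * (t `^ (3 * s) + t `^ s).
  move=> t0; rewrite normrM ger0_norm ?powR_ge0// normrM (ger0_norm (ler0n R 2)) mulrCA.
  rewrite -mulrA ler_wpM2l// mulrC (le_trans (ler_wpM2r (powR_ge0 _ _) (normr_ln_le s0 t0)))//.
  rewrite -mulrA ler_wpM2l ?invr_ge0 ?(ltW s0)// mulrDl -!powRD ?(gt_eqF t0) ?implybT//.
  by rewrite (_ : s + 2 * s = 3 * s) 1?(_ : - s + 2 * s = s)//; ring.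
have C : 2 / s * (t `^ (3 * s) + t `^ s) @[t --> 0^'+] --> (0 : R).
  have : 2 / s * (t `^ (3 * s) + t `^ s) @[t --> 0^'+] --> 2 / s * (0 + 0).
    by apply: cvgMl_tmp; apply: cvgD; apply: powR_cvg0 => //; lra.
  by rewrite addr0 mulr0.
apply: norm_cvg0; apply: (@squeeze_cvgr _ _ _ _ (cst 0) _ _ _ _ _ C); last exact: cvg_cst.
near=> t; rewrite normr_ge0/=; apply: B; near: t; exact: nbhs_right_gt.
Unshelve. all: by end_near. Qed.

Let cvg_powR0 : t `^ (2 * s) @[t --> 0^'+] --> (0 : R).
Proof. by apply: powR_cvg0; rewrite mulr_gt0// s_gt0. Qed.

Lemma cvg_w_s : w_s s u (x, t) @[t --> 0^'+] --> u x.
Proof.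
have C : u x + - (p_ns n s / 2) * (t `^ (2 * s) * poisson_part t) @[t --> 0^'+] --> u x.
  have : u x + - (p_ns n s / 2) * (t `^ (2 * s) * poisson_part t) @[t --> 0^'+] -->
      u x + - (p_ns n s / 2) * (0 * riesz_integral u x s).
    apply: cvgD; first exact: cvg_cst.
    by apply: cvgMl_tmp; apply: cvgM; [exact: cvg_powR0|exact: cvg_poisson_part].
  by rewrite mul0r mulr0 addr0.
apply: cvg_trans C; apply: near_eq_cvg; near=> t.
have t0 : 0 < t by near: t; exact: nbhs_right_gt.
by have := w_s_sub_boundary t0; rewrite -mulrA => <-; rewrite addrC subrK.
Unshelve. all: by end_near. Qed.

Lemma cvg_v_s : v_s s u (x, t) @[t --> 0^'+] --> b_1 n s * u x.
Proof.
have C : b_1 n s * u x + - (p_ns n s / 2) *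
    (t `^ (2 * s) * (2 * ln t) * poisson_part t - t `^ (2 * s) * log_part t) @[t --> 0^'+] --> b_1 n s * u x.
  have : b_1 n s * u x + - (p_ns n s / 2) *
      (t `^ (2 * s) * (2 * ln t) * poisson_part t - t `^ (2 * s) * log_part t) @[t --> 0^'+] -->
      b_1 n s * u x + - (p_ns n s / 2) * (0 * riesz_integral u x s - 0 * (2 * J)).
    apply: cvgD; first exact: cvg_cst.
    apply: cvgMl_tmp; apply: cvgB; apply: cvgM.
    - exact: cvg_powR_ln.
    - exact: cvg_poisson_part.
    - exact: cvg_powR0.
    - exact: cvg_log_part.
  by rewrite !mul0r subr0 mulr0 addr0.
apply: cvg_trans C; apply: near_eq_cvg; near=> t.
have t0 : 0 < t by near: t; exact: nbhs_right_gt.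
have E := v_s_sub_boundary t0.
rewrite -[RHS](subrK (b_1 n s * u x)) E; ring.
Unshelve. all: by end_near. Qed.

(** For each t > 0 the quotient equals -(c/2)(b [poisson_part] - [log_part]) exactly: t^(-2s)
    cancels t^(2s), and [d_s] turns p/2 into c/2. No divergent term is left for the limit. *)
Lemma cvg_extension_quotient :
  d_s n s * ((b_ns n s - 2 * ln t) * t `^ (- (2 * s)) * (w_s s u (x, t) - u x) +
    t `^ (- (2 * s)) * (v_s s u (x, t) - b_1 n s * u x)) @[t --> 0^'+] -->
  - (c_ns n s / 2) * (b_ns n s * riesz_integral u x s - 2 * J).
Proof.
have C : - (c_ns n s / 2) * (b_ns n s * poisson_part t - log_part t) @[t --> 0^'+] -->
    - (c_ns n s / 2) * (b_ns n s * riesz_integral u x s - 2 * J).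
  apply: cvgMl_tmp; apply: cvgB; last exact: cvg_log_part.
  by apply: cvgMl_tmp; exact: cvg_poisson_part.
apply: cvg_trans C; apply: near_eq_cvg; near=> t.
have t0 : 0 < t by near: t; exact: nbhs_right_gt.
rewrite (w_s_sub_boundary t0) (v_s_sub_boundary t0) /d_s powRN.
have p0 : p_ns n s != 0 by rewrite gt_eqF// p_ns_gt0.
have T0 : t `^ (2 * s) != 0 by rewrite gt_eqF// powR_gt0.
by field; rewrite p0 T0.
Unshelve. all: by end_near. Qed.

Lemma fractional_laplacianE tau : 0 < tau < 1 ->
  fractional_laplacian tau u x = c_ns n tau * (2^-1 * riesz_integral u x tau).
Proof.
move=> tau01; rewrite /fractional_laplacian; congr (_ * _); apply/cvg_lim => //.
exact: cvg_truncated_integral.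
Qed.

Lemma is_derive_fractional_laplacian :
  is_derive s 1 (fun tau => fractional_laplacian tau u x)
    (c_ns n s / 2 * (b_ns n s * riesz_integral u x s - 2 * J)).
Proof.
have Dc := derivableP (derivable_c_ns n0 s01).
have DI := is_derive_riesz_integral n0 hu hc x s01.
apply: (@near_eq_is_derive _ _ _ (fun tau => c_ns n tau * (2^-1 * riesz_integral u x tau))).
  (* The formula for the fractional Laplacian is available for orders in (0,1) only, and it is
     transported to a neighbourhood of s before the product rule is applied. *)
  have : s \in `]0, 1[ by rewrite in_itv.
  move=> /near_in_itvoo; apply: filterS => tau; rewrite in_itv/= => tau01.
  by rewrite fractional_laplacianE.
apply: is_derive_eq.
by rewrite -b_nsE// /GRing.scale/= -/J; field.
Qed.

End extension_limits.

(** * Radial potentials *)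

Section potential.
Variables (R : realType) (n : nat).
Local Notation mR := (measurableTypeR R).
Local Notation muN := (lebesgue_Rn R).
Local Notation point := (@Defs.point R n).
Implicit Types (phi : R -> R) (m : 'rV[R]_n -> R) (z v : 'rV[R]_n * R).

(** Continuity is asked for q > 0 only, because q = |x - y|^2 + t^2 never reaches 0 in the open
    half-space; powers and ln are singular at 0. *)
Definition radial_density phi := measurable_fun [set: mR] (phi : mR -> mR) /\
  (forall q, 0 < q -> {for q, continuous phi}).

(** All derivatives fall on the kernel, so no smoothness of m is asked for. A bounding box instead
    of a support condition makes stability under m -> y_i m immediate. *)
Definition boxed m := measurable_Rn m /\ exists M rho : R,
  [/\ 0 <= M, 0 <= rho, forall y, `|m y| <= M &
      forall (y : 'rV[R]_n) i, rho < `|y ord0 i| -> m y = 0].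

Definition sqdist z (y : 'rV[R]_n) : R := enorm (z.1 - y) ^+ 2 + z.2 ^+ 2.

Definition potential phi m z : R := integral_Rn setT (fun y => phi (sqdist z y) * m y).

Lemma radial_density_bounded phi (c B : R) : radial_density phi -> 0 < c ->
  exists2 K, 0 <= K & forall q, c <= q <= B -> `|phi q| <= K.
Proof.
move=> [_ cphi] c0.
have cpt : compact (phi @` `[c, B]).
  apply: continuous_compact; last exact: segment_compact.
  apply: continuous_in_subspaceT => q; rewrite inE/= in_itv/= => /andP[cq _].
  exact: cphi (lt_le_trans c0 cq).
have [M [_ HM]] := compact_bounded cpt.
exists (`|M| + 1) => // q qcB.
apply: (HM (`|M| + 1)); first by rewrite (le_lt_trans (ler_norm M))// ltrDl.
by exists q => //=; rewrite in_itv.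
Qed.

Lemma boxed_coord m (i : 'I_n) : boxed m -> boxed (fun y : 'rV[R]_n => y ord0 i * m y).
Proof.
move=> [mm [M [rho [M0 rho0 mM m0]]]]; split.
  by apply: measurable_funM => //; exact: measurable_coord.
exists (rho * M), rho; split=> [|//|y|y j /m0 ->]; rewrite ?mulr0 ?mulr_ge0//.
have [yi|/m0 ->] := leP `|y ord0 i| rho; last by rewrite mulr0 normr0 mulr_ge0.
by rewrite normrM ler_pM.
Qed.

Lemma boxed_integrable m : boxed m -> integrable_Rn m.
Proof.
move=> [mm [M [rho [M0 rho0 mM m0]]]].
pose box : set (n.-tuple mR) := [set y | forall i, `[- rho, rho]%classic (tnth y i)].
have mbox : measurable box.
  by apply: (@measurable_box R n (fun=> `[- rho, rho]%classic)) => i; exact: measurable_itv.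
have fbox : (muN n box < +oo)%E.
  rewrite (@lebesgue_Rn_box R n (fun=> `[- rho, rho]%classic) (fun=> measurable_itv _)).
  under eq_bigr do rewrite lebesgue_measure_itv/= lte_fin.
  case: ifPn => _; first by rewrite -EFinB prodEFin ltry.
  by rewrite (_ : 0%E = 0%:E)// prodEFin ltry.
have ib : (muN n).-integrable box (EFin \o (fun y => m (point y))).
  apply: measurable_bounded_integrable => //; first exact: measurable_funTS.
  exists M; split; first exact: num_real.
  by move=> K MK y _; rewrite /= (le_trans (mM _))// ltW.
have := (integrable_mkcond (EFin \o (fun y => m (point y))) mbox).1 ib.
rewrite /integrable_Rn; congr (_.-integrable _ _); apply/funext => y.
rewrite patchE; case: ifPn => //; rewrite notin_setE => ybox.
have [i yi] : exists i, ~ `[- rho, rho]%classic (tnth y i) by apply/existsNP.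
rewrite /= (m0 _ i)// mxE ltNge; apply/negP => yr; apply: yi.
by rewrite /= in_itv/= -ler_norml.
Qed.

Lemma sqdist_line z v y (h : R) :
  sqdist (z + h *: v) y = sqdist z y +
    h * (2 * (\sum_(i < n) v.1 ord0 i * (z.1 ord0 i - y ord0 i) + v.2 * z.2)) +
    h ^+ 2 * (enorm v.1 ^+ 2 + v.2 ^+ 2).
Proof.
rewrite /sqdist !enorm_sqr /=.
have -> : \sum_(i < n) (z.1 + h *: v.1 - y) ord0 i ^+ 2 =
    \sum_(i < n) (z.1 - y) ord0 i ^+ 2 +
    h * (2 * \sum_(i < n) v.1 ord0 i * (z.1 ord0 i - y ord0 i)) +
    h ^+ 2 * \sum_(i < n) v.1 ord0 i ^+ 2.
  rewrite !mulr_sumr -!big_split/=; apply: eq_bigr => i _.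
  by rewrite !mxE; ring.
by rewrite /GRing.scale/=; ring.
Qed.

Lemma measurable_sqdist z : measurable_Rn (sqdist z).
Proof.
apply: measurable_funD => //; apply: measurable_funX.
have := measurable_Rn_affine z.1 (-1) (@measurable_enorm R n).
by rewrite /measurable_Rn; under eq_fun do rewrite scaleN1r.
Qed.

Let slope z v (y : 'rV[R]_n) (h : R) : R :=
  2 * (\sum_(i < n) v.1 ord0 i * (z.1 ord0 i - y ord0 i) + v.2 * z.2) +
  2 * h * (enorm v.1 ^+ 2 + v.2 ^+ 2).

Let is_derive_sqdist z v y (h : R) :
  is_derive h 1 (fun h => sqdist (z + h *: v) y) (slope z v y h).
Proof.
under eq_fun do rewrite sqdist_line.
by apply: is_derive_eq; rewrite /slope /GRing.scale/=; ring.
Qed.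

(** With this [del] the height stays above half of z.2 along the segment, hence q >= (z.2/2)^2 for
    every y. For y in the box, q is also bounded above, so densities are evaluated on a compact
    interval of positive numbers. The summand 1 in [del] covers directions with v.2 = 0. *)
Let sqdist_bounds z v (rho : R) : 0 < z.2 -> 0 <= rho ->
  exists del c B P : R, [/\ 0 < del, 0 < c, 0 <= P &
    forall (h : R) (y : 'rV[R]_n), `|h| < del -> [/\ z.2 / 2 <= (z + h *: v).2, c <= sqdist (z + h *: v) y &
      ((forall i, `|y ord0 i| <= rho) ->
       sqdist (z + h *: v) y <= B /\ `|slope z v y h| <= P)]].
Proof.
move=> z20 rho0.
pose del := z.2 / (2 * (1 + `|v.2|)).
have v0 : 0 < 2 * (1 + `|v.2|) by rewrite mulr_gt0// ltr_pwDl.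
have del0 : 0 < del by rewrite divr_gt0.
pose A0 := \sum_(i < n) (`|z.1 ord0 i| + rho) ^+ 2 + z.2 ^+ 2.
pose b0 := 2 * (\sum_(i < n) `|v.1 ord0 i| * (`|z.1 ord0 i| + rho) + `|v.2| * z.2).
pose c2 := enorm v.1 ^+ 2 + v.2 ^+ 2.
have b00 : 0 <= b0.
  rewrite mulr_ge0// addr_ge0 ?mulr_ge0 ?(ltW z20)// sumr_ge0// => i _.
  by rewrite mulr_ge0// addr_ge0.
have c20 : 0 <= c2 by rewrite addr_ge0 ?sqr_ge0.
exists del, ((z.2 / 2) ^+ 2), (A0 + del * b0 + del ^+ 2 * c2), (b0 + 2 * del * c2).
split=> [//|||h y hdel].
- by rewrite exprn_gt0// divr_gt0.
- by rewrite addr_ge0// !mulr_ge0// ltW.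
have hd : `|h| <= del by exact: ltW.
have zh : z.2 / 2 <= (z + h *: v).2.
  rewrite /= -lerBlDl; apply: le_trans (_ : - `|h * v.2| <= _); last first.
    by rewrite lerNl -normrN ler_norm.
  have : `|h| * `|v.2| <= del * (1 + `|v.2|) by rewrite ler_pM// lerDr.
  rewrite (_ : del * _ = z.2 / 2) ?normrM; last by rewrite /del; field; rewrite gt_eqF// ltr_pwDl.
  by lra.
split; [exact: zh| |].
  rewrite /sqdist ler_wpDl ?sqr_ge0//= ler_pXn2r ?nnegrE ?divr_ge0 ?(ltW z20)//.
  by rewrite (le_trans _ zh)// divr_ge0 ?ltW.
move=> yrho.
have xy i : `|z.1 ord0 i - y ord0 i| <= `|z.1 ord0 i| + rho.
  by rewrite (le_trans (ler_normB _ _))// lerD2l.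
have bb : `|2 * (\sum_(i < n) v.1 ord0 i * (z.1 ord0 i - y ord0 i) + v.2 * z.2)| <= b0.
  rewrite normrM (ger0_norm (ler0n R 2)) ler_wpM2l// (le_trans (ler_normD _ _))// lerD//.
    rewrite (le_trans (ler_norm_sum _ _ _))// ler_sum// => i _.
    by rewrite normrM ler_wpM2l.
  by rewrite normrM (gtr0_norm z20).
split.
  rewrite sqdist_line -/c2 !lerD//.
  - rewrite enorm_sqr ler_sum// => i _.
    rewrite !mxE -[X in X <= _]real_normK ?num_real// ler_pXn2r ?nnegrE ?addr_ge0//; exact: xy.
  - by rewrite (le_trans (ler_norm _))// normrM ler_pM.
  - by rewrite ler_wpM2r// -[X in X <= _]real_normK ?num_real// ler_pXn2r ?nnegrE// ltW.
rewrite /slope -/c2 (le_trans (ler_normD _ _))// lerD//.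
by rewrite 2!normrM (ger0_norm (ler0n R 2)) (ger0_norm c20) ler_wpM2r// ler_wpM2l.
Qed.

Lemma measurable_potential_density phi m z : radial_density phi -> boxed m ->
  measurable_Rn (fun y => phi (sqdist z y) * m y).
Proof.
move=> [mphi _] [mm _]; apply: measurable_funM => //.
exact: (measurableT_comp mphi (measurable_sqdist z)).
Qed.

Lemma integrable_potential phi m z : radial_density phi -> boxed m -> 0 < z.2 ->
  integrable_Rn (fun y => phi (sqdist z y) * m y).
Proof.
move=> rphi bm z20; have [mm [M [rho [M0 rho0 mM m0]]]] := bm.
(* Direction 0 and h = 0 reduce the bounds along a segment to bounds at the point z. *)
have [del [c [B [P [del0 c0 P0 H]]]]] := @sqdist_bounds z 0 rho z20 rho0.
have [K K0 HK] := radial_density_bounded B rphi c0.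
apply: (le_integrable_Rn _ _ (integrable_RnZ K (boxed_integrable bm))) => [|y].
  exact: measurable_potential_density.
rewrite !normrM (ger0_norm K0).
have [->|my] := eqVneq (m y) 0; first by rewrite normr0 !mulr0.
rewrite ler_wpM2r// HK//.
have := H 0 y; rewrite normr0 scale0r addr0 => /(_ del0)[_ -> /(_ _)[]// i].
by rewrite leNgt; apply: contra my => /m0 ->.
Qed.

(** Differentiation under the integral takes place in the real variable h along z + h v, dominated
    by K P |m|, and is then read as a directional derivative at h = 0. *)
Lemma is_derive_potential phi phi' m z v :
  radial_density phi -> radial_density phi' -> boxed m -> 0 < z.2 ->
  (forall q : R, 0 < q -> is_derive q 1 phi (phi' q)) ->
  is_derive z v (potential phi m)
    (integral_Rn setT (fun y => phi' (sqdist z y) *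
      (2 * (\sum_(i < n) v.1 ord0 i * (z.1 ord0 i - y ord0 i) + v.2 * z.2)) * m y)).
Proof.
move=> rphi rphi' bm z20 dphi; have [mm [M [rho [M0 rho0 mM m0]]]] := bm.
have [del [c [B [P [del0 c0 P0 H]]]]] := @sqdist_bounds z v rho z20 rho0.
have [K K0 HK] := radial_density_bounded B rphi' c0.
pose F (h : R) (y : n.-tuple mR) := phi (sqdist (z + h *: v) (point y)) * m (point y).
have dF (h : R) y : `|h| < del ->
    is_derive h 1 (F ^~ y) (phi' (sqdist (z + h *: v) (point y)) * slope z v (point y) h * m (point y)).
  move=> hdel; have [_ cq _] := H h (point y) hdel.
  have D1 := dphi _ (lt_le_trans c0 cq).
  have D2 := is_derive_sqdist z v (point y) h.
  have D3 := @is_derive1_comp _ phi (fun h => sqdist (z + h *: v) (point y)) h _ _ D1 D2.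
  by apply: is_derive_eq; rewrite /GRing.scale/=; ring.
have I0 : `](- del), del[%classic (0 : R) by rewrite /= in_itv/= oppr_lt0 del0.
have Idel (h : R) : `](- del), del[%classic h -> `|h| < del.
  by rewrite /= in_itv/= -ltr_norml.
have zh0 h : `|h| < del -> 0 < (z + h *: v).2.
  by move=> /(H h 0)[zh _ _]; apply: lt_le_trans zh; rewrite divr_gt0.
have iF h : `](- del), del[%classic h -> (muN n).-integrable setT (EFin \o F h).
  by move=> /Idel /zh0 zh; exact: (integrable_potential rphi bm zh).
have dF' h y : `](- del), del[%classic h -> [set: n.-tuple mR] y -> derivable (F ^~ y) h 1.
  by move=> /Idel hd _; have [] := dF h y hd.
pose G (y : n.-tuple mR) := K * P * `|m (point y)|.
have G0 y : 0 <= G y by rewrite /G !mulr_ge0.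
have iG : (muN n).-integrable setT (EFin \o G).
  apply: (integrable_RnZ (K * P) _ : integrable_Rn (fun y => K * P * `|m y|)).
  exact: (integrable_norm (boxed_integrable bm)).
have GF h y : `](- del), del[%classic h -> [set: n.-tuple mR] y -> `|partial1of2 F h y| <= G y.
  move=> /Idel hd _; rewrite partial1of2E; have [_ ->] := dF h y hd.
  rewrite /G normrM.
  have [->|my] := eqVneq (m (point y)) 0; first by rewrite normr0 !mulr0.
  rewrite ler_wpM2r// normrM.
  have [_ cq] := H h (point y) hd.
  have yrho i : `|point y ord0 i| <= rho by rewrite leNgt; apply: contra my => /m0 ->.
  by move=> /(_ yrho)[qB sP]; rewrite ler_pM// HK// cq.
have E : (fun h : R => potential phi m (z + h *: v)) = (fun h => \int[muN n]_y F h y).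
  by apply/funext => h; rewrite /potential integral_RnE.
have L : is_derive (0 : R) 1 (fun h : R => potential phi m (z + h *: v))
    (integral_Rn setT (fun y => phi' (sqdist z y) *
      (2 * (\sum_(i < n) v.1 ord0 i * (z.1 ord0 i - y ord0 i) + v.2 * z.2)) * m y)).
  split; rewrite E.
    exact: (@derivable_under_integral _ _ _ (muN n) F setT measurableT 0 _ _ I0 iF dF' G G0 iG GF).
  rewrite -derive1E (@differentiation_under_integral _ _ _ (muN n) F setT measurableT 0 _ _ I0 iF dF' G G0 iG GF).
  rewrite integral_RnE; apply: eq_Rintegral => y _.
  rewrite -[LHS]/(partial1of2 F 0 y) partial1of2E.
  have [|_ ->] := dF 0 y; first by rewrite normr0.
  by rewrite /slope scale0r addr0 mulr0 mul0r addr0.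
by have := (is_derive_line (potential phi m) z v 0 _).1 L; rewrite scale0r addr0.
Qed.

Lemma is_derive_potential_space phi phi' m z (i : 'I_n) :
  radial_density phi -> radial_density phi' -> boxed m -> 0 < z.2 ->
  (forall q : R, 0 < q -> is_derive q 1 phi (phi' q)) ->
  is_derive z (ex R i) (potential phi m)
    (2 * z.1 ord0 i * potential phi' m z -
     2 * potential phi' (fun y => y ord0 i * m y) z).
Proof.
move=> rphi rphi' bm z20 dphi.
have D := is_derive_potential (ex R i) rphi rphi' bm z20 dphi.
have bi := boxed_coord i bm.
apply: (is_derive_eq D).
rewrite /potential -!integral_RnZ; [|exact: integrable_potential..].
rewrite -integral_RnB; [|by apply: integrable_RnZ; exact: integrable_potential..].
apply: eq_integral_Rn => y.
rewrite (bigD1 i)//= big1 => [|j ji]; last by rewrite !mxE eqxx/= (negbTE ji) mul0r.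
by rewrite !mxE !eqxx/=; ring.
Qed.

Lemma is_derive_potential_height phi phi' m z :
  radial_density phi -> radial_density phi' -> boxed m -> 0 < z.2 ->
  (forall q : R, 0 < q -> is_derive q 1 phi (phi' q)) ->
  is_derive z (et R n) (potential phi m) (2 * z.2 * potential phi' m z).
Proof.
move=> rphi rphi' bm z20 dphi.
have D := is_derive_potential (et R n) rphi rphi' bm z20 dphi.
apply: (is_derive_eq D).
rewrite /potential -!integral_RnZ; last exact: integrable_potential.
apply: eq_integral_Rn => y.
rewrite big1 => [|j _]; last by rewrite mxE mul0r.
by rewrite /=; ring.
Qed.

End potential.

(** * The extension equation *)

Section extension_equation.
Variables (R : realType) (n : nat) (s : R).
Implicit Types (m : 'rV[R]_n -> R) (z : 'rV[R]_n * R) (k : R).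
Local Notation mR := (measurableTypeR R).
Local Notation a := ((n%:R + 2 * s) / 2).
Local Notation coord i m := (fun y : 'rV[R]_n => y ord0 i * m y).

Lemma half_space_near z : 0 < z.2 -> \forall z' \near z, 0 < z'.2.
Proof.
move=> z0; have : nbhs z.2 [set t : R | 0 < t] by exact: lt_nbhsr.
exact: (@cvg_snd _ _ (nbhs z.1) (nbhs z.2)).
Qed.

Lemma is_derive_snd (g : R -> R) (d : R) z v : is_derive z.2 1 g d ->
  is_derive z v (fun z => g z.2) (v.2 * d).
Proof.
move=> Dg.
suff L : is_derive (0 : R) 1 (fun h : R => g (z + h *: v).2) (v.2 * d).
  by have := (is_derive_line (fun z => g z.2) z v 0 _).1 L; rewrite scale0r addr0.
have D2 : is_derive (0 : R) 1 (fun h : R => z.2 + h * v.2) v.2.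
  by apply: is_derive_eq; rewrite /GRing.scale/=; ring.
have D1 : is_derive (z.2 + 0 * v.2) 1 g d by rewrite mul0r addr0.
have := @is_derive1_comp _ g (fun h => z.2 + h * v.2) 0 _ _ D1 D2.
by rewrite mulrC.
Qed.

Lemma is_derive_fst (i : 'I_n) z v : is_derive z v (fun z => z.1 ord0 i) (v.1 ord0 i).
Proof.
suff L : is_derive (0 : R) 1 (fun h : R => (z + h *: v).1 ord0 i) (v.1 ord0 i).
  by have := (is_derive_line (fun z => z.1 ord0 i) z v 0 _).1 L; rewrite scale0r addr0.
under eq_fun do rewrite /= !mxE.
by apply: is_derive_eq; rewrite /GRing.scale/=; ring.
Qed.

Let continuous_powR (p q : R) : 0 < q -> {for q, continuous (fun q => q `^ p)}.
Proof.
move=> q0; apply: differentiable_continuous; apply/derivable1_diffP.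
by have := is_derive1_powR p q0 => -[].
Qed.

Lemma radial_density_powR (p : R) : radial_density (fun q : R => q `^ p).
Proof. by split; [exact: measurable_powR|move=> q; exact: continuous_powR]. Qed.

Lemma radial_density_ln_powR (p : R) : radial_density (fun q : R => ln q * q `^ p).
Proof.
split; first by apply: measurable_funM; [exact: measurable_ln|exact: measurable_powR].
move=> q q0; apply: cvgM; [exact: continuous_ln|exact: continuous_powR].
Qed.

Lemma radial_density_comb (f g : R -> R) (c d : R) : radial_density f -> radial_density g ->
  radial_density (fun q => c * f q + d * g q).
Proof.
move=> [mf cf] [mg cg]; split.
  by apply: measurable_funD; apply: measurable_funM.
move=> q q0; apply: cvgD; apply: cvgMl_tmp; [exact: cf|exact: cg].
Qed.

Lemma potential_comb (f g : R -> R) (c d : R) m z : radial_density f -> radial_density g ->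
  boxed m -> 0 < z.2 ->
  potential (fun q => c * f q + d * g q) m z = c * potential f m z + d * potential g m z.
Proof.
move=> rf rg bm z0; have fi := integrable_potential rf bm z0; have gi := integrable_potential rg bm z0.
rewrite /potential -!integral_RnZ// -integral_RnD; [|exact: integrable_RnZ..].
by apply: eq_integral_Rn => y; ring.
Qed.

(** The index k counts differentiations of the kernel: each derivative of q^(-(a+k)) raises it by
    one. *)
Definition pow_potential k m z := potential (fun q => q `^ (- (a + k))) m z.
Definition log_potential k m z := potential (fun q => ln q * q `^ (- (a + k))) m z.
Local Notation P := pow_potential.
Local Notation Q := log_potential.

Let rP k := radial_density_powR (- (a + k)).
Let rQ k := radial_density_ln_powR (- (a + k)).

(** The second summand, with coefficient 0, gives the two-term shape of [radial_density_comb] and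
    [potential_comb], shared with the logarithmic density. *)
Let dP0 k (q : R) : 0 < q -> is_derive q 1 (fun q => q `^ (- (a + k)))
  (- (a + k) * q `^ (- (a + (k + 1))) + 0 * q `^ (- (a + (k + 1)))).
Proof.
move=> q0; have D := is_derive1_powR (- (a + k)) q0.
apply: (is_derive_eq D); rewrite mul0r addr0; congr (_ * _ `^ _); ring.
Qed.

Let dQ0 k (q : R) : 0 < q -> is_derive q 1 (fun q => ln q * q `^ (- (a + k)))
  (1 * q `^ (- (a + (k + 1))) + - (a + k) * (ln q * q `^ (- (a + (k + 1))))).
Proof.
move=> q0; have D1 := is_derive1_powR (- (a + k)) q0; have D2 := is_derive1_ln q0.
apply: is_derive_eq.
rewrite /GRing.scale/= (_ : - (a + k) - 1 = - (a + (k + 1))); last by ring.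
rewrite (_ : q `^ (- (a + k)) = q * q `^ (- (a + (k + 1)))); last first.
  rewrite -{2}(powRr1 (ltW q0)) -powRD ?(gt_eqF q0) ?implybT//; congr (_ `^ _); ring.
by field; rewrite gt_eqF.
Qed.

Let dP_height k m z : boxed m -> 0 < z.2 ->
  is_derive z (et R n) (P k m) (- 2 * (a + k) * z.2 * P (k + 1) m z).
Proof.
move=> bm z0.
have r := radial_density_comb (- (a + k)) 0 (rP (k + 1)) (rP (k + 1)).
have D := is_derive_potential_height (rP k) r bm z0 (@dP0 k).
apply: (is_derive_eq D).
by rewrite (potential_comb _ _ (rP (k + 1)) (rP (k + 1)) bm z0) -/(P (k + 1) m z); ring.
Qed.

Let dQ_height k m z : boxed m -> 0 < z.2 ->
  is_derive z (et R n) (Q k m) (2 * z.2 * (P (k + 1) m z - (a + k) * Q (k + 1) m z)).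
Proof.
move=> bm z0.
have r := radial_density_comb 1 (- (a + k)) (rP (k + 1)) (rQ (k + 1)).
have D := is_derive_potential_height (rQ k) r bm z0 (@dQ0 k).
apply: (is_derive_eq D).
by rewrite (potential_comb _ _ (rP (k + 1)) (rQ (k + 1)) bm z0) -/(P (k + 1) m z) -/(Q (k + 1) m z); ring.
Qed.

Let dP_space k m z (i : 'I_n) : boxed m -> 0 < z.2 ->
  is_derive z (ex R i) (P k m)
    (- 2 * (a + k) * (z.1 ord0 i * P (k + 1) m z - P (k + 1) (coord i m) z)).
Proof.
move=> bm z0; have bi := boxed_coord i bm.
have r := radial_density_comb (- (a + k)) 0 (rP (k + 1)) (rP (k + 1)).
have D := is_derive_potential_space i (rP k) r bm z0 (@dP0 k).
apply: (is_derive_eq D).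
rewrite !(potential_comb _ _ (rP (k + 1)) (rP (k + 1)) _ z0)//.
by rewrite -/(P (k + 1) m z) -/(P (k + 1) (coord i m) z); ring.
Qed.

Let dQ_space k m z (i : 'I_n) : boxed m -> 0 < z.2 ->
  is_derive z (ex R i) (Q k m)
    (2 * (z.1 ord0 i * P (k + 1) m z - P (k + 1) (coord i m) z) -
     2 * (a + k) * (z.1 ord0 i * Q (k + 1) m z - Q (k + 1) (coord i m) z)).
Proof.
move=> bm z0; have bi := boxed_coord i bm.
have r := radial_density_comb 1 (- (a + k)) (rP (k + 1)) (rQ (k + 1)).
have D := is_derive_potential_space i (rQ k) r bm z0 (@dQ0 k).
apply: (is_derive_eq D).
rewrite !(potential_comb _ _ (rP (k + 1)) (rQ (k + 1)) _ z0)//.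
by rewrite -/(P (k + 1) m z) -/(P (k + 1) (coord i m) z) -/(Q (k + 1) m z) -/(Q (k + 1) (coord i m) z); ring.
Qed.

(* P1 and P2 integrate (x_i - y_i) q^(-(a+k)) and (x_i - y_i)^2 q^(-(a+k)) against m,
   with q = |x - y|^2 + t^2; Q1 and Q2 carry an extra factor ln q. *)
Let P1 k m (i : 'I_n) z := z.1 ord0 i * P k m z - P k (coord i m) z.
Let Q1 k m (i : 'I_n) z := z.1 ord0 i * Q k m z - Q k (coord i m) z.
Let P2 k m (i : 'I_n) z := z.1 ord0 i * P1 k m i z - P1 k (coord i m) i z.
Let Q2 k m (i : 'I_n) z := z.1 ord0 i * Q1 k m i z - Q1 k (coord i m) i z.

Let dP1 k m z i : boxed m -> 0 < z.2 ->
  is_derive z (ex R i) (P1 k m i) (P k m z - 2 * (a + k) * P2 (k + 1) m i z).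
Proof.
move=> bm z0; have bi := boxed_coord i bm.
have D1 := dP_space k i bm z0; have D2 := dP_space k i bi z0.
have D3 := is_derive_fst i z (ex R i).
apply: is_derive_eq.
by rewrite /GRing.scale/= !mxE !eqxx /P2 /P1/=; ring.
Qed.

Let dQ1 k m z i : boxed m -> 0 < z.2 ->
  is_derive z (ex R i) (Q1 k m i)
    (Q k m z + 2 * P2 (k + 1) m i z - 2 * (a + k) * Q2 (k + 1) m i z).
Proof.
move=> bm z0; have bi := boxed_coord i bm.
have D1 := dQ_space k i bm z0; have D2 := dQ_space k i bi z0.
have D3 := is_derive_fst i z (ex R i).
apply: is_derive_eq.
by rewrite /GRing.scale/= !mxE !eqxx /P2 /P1 /Q2 /Q1/=; ring.
Qed.

Let integral_Rn_sum (I : Type) (r : seq I) (f : I -> 'rV[R]_n -> R) :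
  (forall i, integrable_Rn (f i)) ->
  integrable_Rn (fun y => \sum_(i <- r) f i y) /\
  \sum_(i <- r) integral_Rn setT (f i) = integral_Rn setT (fun y => \sum_(i <- r) f i y).
Proof.
move=> fi; elim: r => [|i r [ir IH]].
  split.
    apply: (@eq_integrable_Rn _ _ (fun=> 0)) => [y|]; first by rewrite big_nil.
    exact: integrable0.
  rewrite big_nil (@eq_integral_Rn _ _ _ (fun=> 0)) => [|y]; last by rewrite big_nil.
  by rewrite integral_RnE Rintegral_cst// mul0r.
rewrite big_cons IH -(integral_RnD (fi i) ir); split.
  by apply: eq_integrable_Rn (integrable_RnD (fi i) ir) => y; rewrite big_cons.
by apply: eq_integral_Rn => y; rewrite big_cons.
Qed.

(** Summing (x_i - y_i)^2 over i gives q - t^2, and multiplication by q turns the density f into g,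
    that is index k + 1 back into k. *)
Let sum_second_moment (f : R -> R) (g : R -> R) m z : radial_density f -> radial_density g ->
  (forall q, 0 < q -> g q = q * f q) -> boxed m -> 0 < z.2 ->
  \sum_(i < n) (z.1 ord0 i * (z.1 ord0 i * potential f m z - potential f (coord i m) z) -
    (z.1 ord0 i * potential f (coord i m) z - potential f (coord i (coord i m)) z)) =
  potential g m z - z.2 ^+ 2 * potential f m z.
Proof.
move=> rf rg gf bm z0.
pose h i (y : 'rV[R]_n) := (z.1 ord0 i - y ord0 i) ^+ 2 * (f (sqdist z y) * m y).
have hE i : integrable_Rn (h i) /\ z.1 ord0 i * (z.1 ord0 i * potential f m z - potential f (coord i m) z) -
    (z.1 ord0 i * potential f (coord i m) z - potential f (coord i (coord i m)) z) =
    integral_Rn setT (h i).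
  have bi := boxed_coord i bm; have bii := boxed_coord i bi.
  have i0 := integrable_potential rf bm z0; have i1 := integrable_potential rf bi z0.
  have i2 := integrable_potential rf bii z0.
  set x := z.1 ord0 i.
  have e y : h i y = x * (x * (f (sqdist z y) * m y) - f (sqdist z y) * (y ord0 i * m y)) -
      (x * (f (sqdist z y) * (y ord0 i * m y)) - f (sqdist z y) * (y ord0 i * (y ord0 i * m y))).
    by rewrite /h -/x; ring.
  have j0 := integrable_RnZ x i0; have j1 := integrable_RnZ x i1.
  have l0 := integrable_RnB j0 i1; have l1 := integrable_RnB j1 i2.
  have l2 := integrable_RnZ x l0.
  split; first by apply: eq_integrable_Rn (integrable_RnB l2 l1) => y; rewrite e.
  by rewrite (eq_integral_Rn e) (integral_RnB l2 l1) (integral_RnZ x l0) (integral_RnB j0 i1)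
    (integral_RnB j1 i2) (integral_RnZ x i0) (integral_RnZ x i1).
under eq_bigr => i _ do rewrite (hE i).2.
have [_ ->] := integral_Rn_sum (index_enum 'I_n) (fun i => (hE i).1).
rewrite /potential -integral_RnZ; last exact: integrable_potential.
rewrite -integral_RnB; [|exact: integrable_potential|by apply: integrable_RnZ; exact: integrable_potential].
apply: eq_integral_Rn => y.
rewrite -mulr_suml (_ : \sum_i _ = enorm (z.1 - y) ^+ 2); last first.
  by rewrite enorm_sqr; apply: eq_bigr => i _; rewrite !mxE.
rewrite gf; last by rewrite /sqdist ltr_wpDl ?sqr_ge0// exprn_gt0.
rewrite (_ : enorm (z.1 - y) ^+ 2 = sqdist z y - z.2 ^+ 2); last by rewrite /sqdist addrK.
by ring.
Qed.

Let sumP2 k m z : boxed m -> 0 < z.2 ->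
  \sum_(i < n) P2 (k + 1) m i z = P k m z - z.2 ^+ 2 * P (k + 1) m z.
Proof.
move=> bm z0; apply: (sum_second_moment (rP (k + 1)) (rP k)) => // q q0.
rewrite -{2}(powRr1 (ltW q0)) -powRD ?(gt_eqF q0) ?implybT//; congr (_ `^ _); ring.
Qed.

Let sumQ2 k m z : boxed m -> 0 < z.2 ->
  \sum_(i < n) Q2 (k + 1) m i z = Q k m z - z.2 ^+ 2 * Q (k + 1) m z.
Proof.
move=> bm z0; apply: (sum_second_moment (rQ (k + 1)) (rQ k)) => // q q0.
rewrite mulrCA; congr (_ * _).
rewrite -{2}(powRr1 (ltW q0)) -powRD ?(gt_eqF q0) ?implybT//; congr (_ `^ _); ring.
Qed.

Variable u : 'rV[R]_n -> R.
Hypothesis bu : boxed u.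
Local Notation p := (p_ns n s).

Lemma w_s_potential z : 0 < z.2 -> w_s s u z = p * z.2 `^ (2 * s) * P 0 u z.
Proof.
move=> z0; rewrite /w_s -mulrA; congr (_ * _).
rewrite /P /potential -integral_RnZ; last exact: (integrable_potential (rP 0) bu z0).
by apply: eq_integral_Rn => y; rewrite addr0 powRN /sqdist; ring.
Qed.

Lemma v_s_potential z : 0 < z.2 ->
  v_s s u z = p * z.2 `^ (2 * s) * (2 * ln z.2 * P 0 u z - Q 0 u z).
Proof.
move=> z0; rewrite /v_s; congr (_ * _).
have iP := integrable_potential (rP 0) bu z0; have iQ := integrable_potential (rQ 0) bu z0.
rewrite /P /Q /potential -integral_RnZ// -integral_RnB//; last exact: integrable_RnZ.
by apply: eq_integral_Rn => y; rewrite addr0 powRN -/(sqdist z y); ring.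
Qed.

Let near_w_s z : 0 < z.2 ->
  \forall z' \near z, p * z'.2 `^ (2 * s) * P 0 u z' = w_s s u z'.
Proof. by move=> /half_space_near; apply: filterS => z' z0; rewrite w_s_potential. Qed.

Let near_v_s z : 0 < z.2 ->
  \forall z' \near z, p * z'.2 `^ (2 * s) * (2 * ln z'.2 * P 0 u z' - Q 0 u z') = v_s s u z'.
Proof. by move=> /half_space_near; apply: filterS => z' z0; rewrite v_s_potential. Qed.

Let powR_pred (t q : R) : 0 < t -> t `^ (q - 1) = t `^ q / t.
Proof. by move=> t0; rewrite powRB ?(gt_eqF t0) ?implybT// powRr1// ltW. Qed.

Lemma is_derive_w_s_height z : 0 < z.2 ->
  is_derive z (et R n) (w_s s u)
    (p * z.2 `^ (2 * s) * (2 * s / z.2 * P 0 u z - 2 * a * z.2 * P 1 u z)).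
Proof.
move=> z0; apply: near_eq_is_derive (near_w_s z0) _.
have D1 := is_derive_snd (et R n) (is_derive1_powR (2 * s) z0).
have := dP_height 0 bu z0; rewrite addr0 add0r => D2.
apply: is_derive_eq.
by rewrite /GRing.scale/= powR_pred//; field; rewrite gt_eqF.
Qed.

Let grad_space (i : 'I_n) z : R :=
  - 4 * a * ln z.2 * P1 1 u i z - 2 * P1 1 u i z + 2 * a * Q1 1 u i z.

Let is_derive_v_s_space (i : 'I_n) z : 0 < z.2 ->
  is_derive z (ex R i) (v_s s u) (p * z.2 `^ (2 * s) * grad_space i z).
Proof.
move=> z0; apply: near_eq_is_derive (near_v_s z0) _.
have D1 := is_derive_snd (ex R i) (is_derive1_powR (2 * s) z0).
have D2 := is_derive_snd (ex R i) (is_derive1_ln z0).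
have := dP_space 0 i bu z0; rewrite addr0 add0r => D3.
have := dQ_space 0 i bu z0; rewrite addr0 add0r => D4.
apply: is_derive_eq.
by rewrite /GRing.scale/= /grad_space /P1 /Q1; ring.
Qed.

(** The height derivative of v_s without its factor p t^(2s), and multiplied by t. The weighted
    height component is then p times this expression, free of quotients and of powers involving
    s. *)
Let grad_height z : R :=
  2 * s * (2 * ln z.2 * P 0 u z - Q 0 u z) + 2 * P 0 u z
  - 4 * a * z.2 ^+ 2 * ln z.2 * P 1 u z - 2 * z.2 ^+ 2 * (P 1 u z - a * Q 1 u z).

Let is_derive_v_s_height z : 0 < z.2 ->
  is_derive z (et R n) (v_s s u) (p * z.2 `^ (2 * s) * (grad_height z / z.2)).
Proof.
move=> z0; apply: near_eq_is_derive (near_v_s z0) _.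
have D1 := is_derive_snd (et R n) (is_derive1_powR (2 * s) z0).
have D2 := is_derive_snd (et R n) (is_derive1_ln z0).
have := dP_height 0 bu z0; rewrite addr0 add0r => D3.
have := dQ_height 0 bu z0; rewrite addr0 add0r => D4.
apply: is_derive_eq.
by rewrite /GRing.scale/= powR_pred// /grad_height; field; rewrite gt_eqF.
Qed.

(** The weight cancels t^(2s), so the fields to be differentiated once more contain only integer
    powers of t, ln t and potentials, which [ring] and [field] can handle. *)
Let weight z : 0 < z.2 -> z.2 `^ (1 - 2 * s) * (p * z.2 `^ (2 * s)) = p * z.2.
Proof.
move=> z0; rewrite mulrCA -powRD ?(gt_eqF z0) ?implybT//.
by rewrite subrK powRr1// ltW.
Qed.

Let is_derive_weighted_space (i : 'I_n) z : 0 < z.2 ->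
  is_derive z (ex R i) (fun z => (weighted_gradient s (v_s s u) z).1 ord0 i)
    (p * z.2 * (- 4 * a * ln z.2 * (P 1 u z - 2 * (a + 1) * P2 (1 + 1) u i z)
      - 2 * (P 1 u z - 2 * (a + 1) * P2 (1 + 1) u i z)
      + 2 * a * (Q 1 u z + 2 * P2 (1 + 1) u i z - 2 * (a + 1) * Q2 (1 + 1) u i z))).
Proof.
move=> z0; apply: (@near_eq_is_derive _ _ _ (fun z => p * z.2 * grad_space i z)).
  have := half_space_near z0; apply: filterS => z' z'0.
  rewrite /weighted_gradient /gradient/= !mxE.
  by have [_ ->] := is_derive_v_s_space i z'0; rewrite mulrA weight.
have D1 := is_derive_snd (ex R i) (is_derive_id z.2 1).
have D2 := is_derive_snd (ex R i) (is_derive1_ln z0).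
have D3 := @dP1 1 u z i bu z0; have D4 := @dQ1 1 u z i bu z0.
apply: is_derive_eq.
by rewrite /GRing.scale/=; ring.
Qed.

Let is_derive_weighted_height z : 0 < z.2 ->
  is_derive z (et R n) (fun z => (weighted_gradient s (v_s s u) z).2)
    (p * (2 * s * (2 / z.2 * P 0 u z - 4 * a * z.2 * ln z.2 * P 1 u z
        - 2 * z.2 * (P 1 u z - a * Q 1 u z))
      - 4 * a * z.2 * P 1 u z
      - 4 * a * ((2 * z.2 * ln z.2 + z.2) * P 1 u z
         - 2 * (a + 1) * z.2 ^+ 3 * ln z.2 * P (1 + 1) u z)
      - 4 * z.2 * (P 1 u z - a * Q 1 u z)
      - 2 * z.2 ^+ 2 * (- 2 * (a + 1) * z.2 * P (1 + 1) u z
         - a * (2 * z.2 * (P (1 + 1) u z - (a + 1) * Q (1 + 1) u z))))).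
Proof.
move=> z0; apply: (@near_eq_is_derive _ _ _ (fun z => p * grad_height z)).
  have := half_space_near z0; apply: filterS => z' z'0.
  rewrite /weighted_gradient /gradient/= /GRing.scale/=.
  have [_ ->] := is_derive_v_s_height z'0.
  rewrite (mulrA (z'.2 `^ (1 - 2 * s))) weight//.
  by field; rewrite gt_eqF.
have D1 := is_derive_snd (et R n) (is_derive_id z.2 1).
have D2 := is_derive_snd (et R n) (is_derive1_ln z0).
have := dP_height 0 bu z0; rewrite addr0 add0r => D3.
have := dQ_height 0 bu z0; rewrite addr0 add0r => D4.
have D5 := dP_height 1 bu z0; have D6 := dQ_height 1 bu z0.
apply: is_derive_eq.
by rewrite /GRing.scale/=; field; rewrite gt_eqF.
Qed.

Lemma v_s_extension_equation z : 0 < z.2 ->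
  [/\ has_gradient (v_s s u) z, has_divergence (weighted_gradient s (v_s s u)) z &
      divergence (weighted_gradient s (v_s s u)) z =
      2 * z.2 `^ (- (2 * s)) * 'D_(et R n) (w_s s u) z].
Proof.
move=> z0; split.
- by split=> [i|]; [have [] := is_derive_v_s_space i z0|have [] := is_derive_v_s_height z0].
- by split=> [i|]; [have [] := is_derive_weighted_space i z0|have [] := is_derive_weighted_height z0].
rewrite /divergence; have [_ ->] := is_derive_weighted_height z0.
have [_ ->] := is_derive_w_s_height z0.
have -> : \sum_(i < n) 'D_(ex R i) (fun y => (weighted_gradient s (v_s s u) y).1 ord0 i) z =
    p * z.2 * (n%:R * (- 4 * a * ln z.2 * P 1 u z - 2 * P 1 u z + 2 * a * Q 1 u z)
      + (8 * a * (a + 1) * ln z.2 + 4 * (a + 1) + 4 * a) * (P 1 u z - z.2 ^+ 2 * P (1 + 1) u z)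
      - 4 * a * (a + 1) * (Q 1 u z - z.2 ^+ 2 * Q (1 + 1) u z)).
  (* Used from left to right, it spreads the closed form over the coordinates so that the comparison
     is made for each i separately. *)
  have S (A B C : R) (F G : 'I_n -> R) :
      n%:R * A + B * \sum_(i < n) F i - C * \sum_(i < n) G i = \sum_(i < n) (A + B * F i - C * G i).
    by rewrite sumrB big_split/= sumr_const card_ord mulr_natl -!mulr_sumr.
  rewrite -sumP2// -sumQ2// S mulr_sumr; apply: eq_bigr => i _.
  by have [_ ->] := is_derive_weighted_space i z0; ring.
rewrite powRN; have T0 : z.2 `^ (2 * s) != 0 by rewrite gt_eqF// powR_gt0.
(* The potentials with k = 2 cancel between space and height. The terms in ln t P 1 and in Q 1
   cancel because 2a = n + 2s. What remains, p (4s P 0 / t - 4a t P 1), is the right-hand side. *)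
by field; rewrite T0 gt_eqF.
Qed.

End extension_equation.

Section boxed_test_function.
Variables (R : realType) (n : nat) (u : 'rV[R]_n -> R).
Hypotheses (hu : smooth u) (hc : compactly_supported u).

Lemma compactly_supported_boxed : boxed u.
Proof.
have [M M0 HM] := compactly_supported_bounded hu hc.
have [rho rho0 Hrho] := compactly_supported_outside hc.
by split; [exact: measurable_Rn_u|exists M, rho].
Qed.

End boxed_test_function.

Theorem theorem1p3 (R : realType) (n : nat) (s : R) (u : 'rV[R]_n -> R)
    (hn : (1 <= n)%N) (hs : 0 < s < 1)
    (hu : smooth u) (hc : compactly_supported u) :
  let w := w_s s u in
  let v := v_s s u in
  let F x t :=
    d_s n s * ((b_ns n s - 2 * ln t) * t `^ (- (2 * s)) *
                 (w (x, t) - boundary_value w x) +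
               t `^ (- (2 * s)) * (v (x, t) - boundary_value v x)) in
  [/\ has_boundary_values w u,
      forall z, half_space z -> derivable w z (et R n),
      solves_weighted_dirichlet s v
        (fun z => 2 * z.2 `^ (- (2 * s)) * 'D_(et R n) w z)
        (fun x => b_1 n s * u x) &
      forall x : 'rV[R]_n,
        [/\ fractional_log_laplacian_defined s u x,
            cvg (F x t @[t --> 0^'+]) &
            fractional_log_laplacian s u x = - lim (F x t @[t --> 0^'+])]].
Proof.
move=> w v F.
have bu := compactly_supported_boxed hu hc.
have w_lim x : w (x, t) @[t --> 0^'+] --> u x by exact: cvg_w_s.
have v_lim x : v (x, t) @[t --> 0^'+] --> b_1 n s * u x by exact: cvg_v_s.
split=> // [z z0||x].
- by have [] := is_derive_w_s_height s bu z0.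
- by split=> // z z0; exact: v_s_extension_equation.
have F_lim : F x t @[t --> 0^'+] --> - (c_ns n s / 2) * (b_ns n s * riesz_integral u x s -
    2 * integral_Rn setT (fun z => second_difference u x z * (ln (enorm z) * riesz s z))).
  (* The boundary values inside F are themselves limits, and are evaluated to u(x) and b_1 u(x)
     before the outer limit is taken. *)
  rewrite /F /boundary_value (cvg_lim _ (w_lim x))// (cvg_lim _ (v_lim x))//.
  exact: cvg_extension_quotient.
have [laplacian_derivable laplacian_derive] := is_derive_fractional_laplacian hn hu hc x hs.
split.
- split=> // tau tau01; apply/cvg_ex; eexists; exact: cvg_truncated_integral.
- by apply/cvg_ex; eexists; exact: F_lim.
- by rewrite (cvg_lim _ F_lim)// /fractional_log_laplacian derive1E laplacian_derive mulNr opprK.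
Qed.
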